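(* Let $\mathcal{G}$ be the Grigorchuk group with generating set $S=\{a,b,c,d\}$, and let $F:\partial\mathcal{T}\to\mathrm{Sch}(\mathcal{G},S)$ be the mapping that assigns to any point $\xi$ on the boundary of the binary rooted tree the marked Schreier graph of its orbit under the action of $\mathcal{G}$ (with marked vertex $\xi$). Let $\Omega$ be the set of non-isolated points of the closure of $F(\partial\mathcal{T})$ in $\mathrm{Sch}(\mathcal{G},S)$. Then: (i) $\Omega$ is a minimal invariant set for the action of $\mathcal{G}$ on $\mathrm{Sch}(\mathcal{G},S)$; (ii) the action of $\mathcal{G}$ on $\Omega$ is a continuous extension of the action of $\mathcal{G}$ on $\partial\mathcal{T}$; the extension is one-to-one everywhere except for a countable set, where it is three-to-one (i.e., there is a continuous surjective $\mathcal{G}$-equivariant map $\Omega\to\partial\mathcal{T}$ and a countable subset of $\partial\mathcal{T}$ such that each point of this subset has exactly three preimages and every other point of $\partial\mathcal{T}$ has exactly one preimage); (iii) there exists a unique Borel probability measure $\nu$ on $\mathrm{Sch}(\mathcal{G},S)$ invariant under the action of $\mathcal{G}$ and supported on the set $\Omega$; (iv) the action of $\mathcal{G}$ on $\Omega$ with the invariant measure $\nu$ is isomorphic to the action of $\mathcal{G}$ on $\partial\mathcal{T}$ with the uniform measure.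
   Context: Graphs. A directed graph with labeled edges has a vertex set $V$, a set of edges $E$, and maps assigning to each $e\in E$ a beginning $\alpha(e)\in V$, an end $\omega(e)\in V$ and a label $l(e)$; loops and multiple edges are allowed. A marked graph has in addition a distinguished (marked) vertex. An isomorphism of graphs is a bijection of vertex sets, accompanied by a bijection of edge sets, preserving beginnings, ends, labels, and the marked vertex. Subgraph means induced subgraph. Distance between vertices is the length of the shortest path, ignoring directions of edges. The closed ball of radius $n$ about a vertex $v$ is the subgraph on all vertices at distance at most $n$ from $v$. Metric. $\mathcal{MG}_0$ is the set of isomorphism classes of connected, locally finite marked directed graphs with labeled edges, with the metric $\delta(\Gamma_1,\Gamma_2)=0$ if $\Gamma_1,\Gamma_2$ are isomorphic, and otherwise $\delta(\Gamma_1,\Gamma_2)=2^{-n}$ where $n\ge0$ is the smallest integer such that the closed balls of radius $n$ about the marked vertices (as marked graphs) are not isomorphic. Schreier graphs. For a group $G$ with finite symmetric generating set $S$ and an action $A$ of $G$ on a set $M$, the Schreier graph has vertex set $M$, edge set $M\times S$, and the edge $(x,s)$ has beginning $x$, end $A_s(x)$, label $s$. The marked Schreier graph $\Gamma^*(A,x)$ of $x\in M$ is the Schreier graph of the restriction of $A$ to the orbit of $x$, with $x$ marked. $\mathrm{Sch}(G,S)\subset\mathcal{MG}_0$ is the set of isomorphism classes of all marked Schreier graphs of all actions of $G$, with the topology given by $\delta$. $G$ acts on $\mathrm{Sch}(G,S)$ by changing the marked vertex: $g$ sends $\Gamma^*(A,x)$ to $\Gamma^*(A,A_g(x))$; this is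 well defined and continuous. Grigorchuk group. Let $X=\{0,1\}$; the set $X^*$ of finite words is the vertex set of the binary rooted tree $\mathcal{T}$, and the boundary $\partial\mathcal{T}=X^{\mathbb{N}}$ is the set of infinite words with the product topology; the uniform measure on $\partial\mathcal{T}$ is the uniform Bernoulli measure. $\mathcal{G}$ is the group of automorphisms of $\mathcal{T}$ generated by $a,b,c,d$, which fix the empty word and satisfy, for every word $w$: $a(0w)=1w$, $a(1w)=0w$; $b(0w)=0a(w)$, $b(1w)=1c(w)$; $c(0w)=0a(w)$, $c(1w)=1d(w)$; $d(0w)=0w$, $d(1w)=1b(w)$. The same formulas give the action of $\mathcal{G}$ on $\partial\mathcal{T}$. The generators are involutions, so $S=\{a,b,c,d\}$ is symmetric. Minimal invariant set: a nonempty closed invariant set in which every orbit is dense. A measure is supported on $\Omega$ if the complement of $\Omega$ has measure zero. Two actions $A$ on $M_1$ and $B$ on $M_2$ of a group $G$ are conjugated if there is a bijection $f:M_1\to M_2$ (a conjugacy) with $B_g=fA_gf^{-1}$ for all $g\in G$; two measure-preserving actions are isomorphic if they are conjugated and, moreover, the conjugacy can be chosen to be an isomorphism of spaces with measure.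
   Formalization: In (iv) the isomorphism is taken modulo null sets: the conjugacy is a bijection between invariant Borel subsets of full measure of Ω and ∂T, since no equivariant bijection of all of Ω onto ∂T exists (three points of Ω have the same stabilizer as 1^∞). *)

(* Defs.v *)
From HB Require Import structures.
From mathcomp Require Import all_boot all_order all_algebra.
From mathcomp Require Import generic_quotient.
From mathcomp Require Import all_classical all_reals all_analysis.

Set Implicit Arguments.
Unset Strict Implicit.
Unset Printing Implicit Defensive.

Import Order.TTheory GRing.Theory Num.Theory.
Local Open Scope classical_set_scope.

Lemma eq_sval (T : Type) (P : T -> Prop) (u v : {x | P x}) :
  sval u = sval v -> u = v.
Proof. by case: u v => [u Pu] [v Pv] /= uv; exact: eq_exist. Qed.

(* The quotient [MG0] below has to be a [choiceType], so the universe of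
   vertices and edges lies strictly below that of [choiceType].  This is why
   subsets used as types of vertices or edges are written with [sig] and not
   with [set_type], and why Schreier graphs are defined for the (small) concrete
   type [grigorchuk] and not for an arbitrary [groupType]. *)
Record mgraph (L : Type) := MGraph {
  vertex : Type;
  edge : Type;
  src : edge -> vertex;
  tgt : edge -> vertex;
  label : edge -> L;
  root : vertex }.
Arguments src {L m}.
Arguments tgt {L m}.
Arguments label {L m}.
Arguments root {L m}.

Section Graphs.
Variable L : Type.
Implicit Types Gam : mgraph L.

Definition mgraph_iso Gam1 Gam2 : Prop :=
  exists (f : vertex Gam1 -> vertex Gam2) (k : edge Gam1 -> edge Gam2),
    [/\ bijective f, bijective k, f root = root &
        forall e, [/\ src (k e) = f (src e), tgt (k e) = f (tgt e) &
                      label (k e) = label e]].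

Definition adjacent Gam (v w : vertex Gam) : Prop :=
  exists e : edge Gam, (src e = v /\ tgt e = w) \/ (src e = w /\ tgt e = v).

Fixpoint upath Gam (n : nat) (v w : vertex Gam) : Prop :=
  if n is m.+1 then exists2 u, adjacent v u & upath m u w else v = w.

Definition dist_le Gam (v w : vertex Gam) (n : nat) : Prop :=
  exists2 m, (m <= n)%N & upath m v w.

Definition connected_graph Gam : Prop :=
  forall v w : vertex Gam, exists n, upath n v w.

Definition locally_finite Gam : Prop :=
  forall v : vertex Gam, finite_set [set e : edge Gam | src e = v \/ tgt e = v].

Section InducedSubgraph.
Variables (Gam : mgraph L) (U : set (vertex Gam)) (Uroot : U root).

Definition induced_edges : set (edge Gam) := [set e | U (src e) /\ U (tgt e)].

Definition induced_src (e : {e | induced_edges e}) : {v | U v} :=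
  exist _ (src (sval e)) (svalP e).1.

Definition induced_tgt (e : {e | induced_edges e}) : {v | U v} :=
  exist _ (tgt (sval e)) (svalP e).2.

Definition induced : mgraph L :=
  MGraph induced_src induced_tgt (fun e => label (sval e)) (exist _ root Uroot).
End InducedSubgraph.

Lemma adjacent_sym Gam (v w : vertex Gam) : adjacent v w -> adjacent w v.
Proof. by move=> [e [[]|[]]] <- <-; exists e; [right|left]. Qed.

Lemma upath_cat Gam m n (v w u : vertex Gam) :
  upath m v w -> upath n w u -> upath (m + n) v u.
Proof.
elim: m v => [|m IH] v /=; first by move=> ->.
by move=> [t vt tw] wu; exists t => //; exact: IH.
Qed.

Lemma upath_sym Gam n (v w : vertex Gam) : upath n v w -> upath n w v.
Proof.
elim: n v => [|n IH] v //= [t /adjacent_sym tv /IH wt].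
suff : upath (n + 1) w v by rewrite addn1.
by apply: (upath_cat wt); exists v.
Qed.

Lemma root_in_ball Gam n : dist_le (@root L Gam) root n.
Proof. by exists 0%N. Qed.

Definition ball_graph Gam (n : nat) : mgraph L :=
  @induced Gam [set v | dist_le root v n] (root_in_ball Gam n).

Lemma mgraph_iso_refl Gam : mgraph_iso Gam Gam.
Proof. by exists id, id; split=> //; exists id. Qed.

Lemma mgraph_iso_sym Gam1 Gam2 : mgraph_iso Gam1 Gam2 -> mgraph_iso Gam2 Gam1.
Proof.
move=> [f [k [[f' fK f'K] [k' kK k'K] froot fk]]].
exists f', k'; split; [by exists f|by exists k|by rewrite -froot fK|].
move=> e; have [s t l] := fk (k' e); rewrite !k'K in s t l.
by rewrite s t l !fK.
Qed.

Lemma mgraph_iso_trans Gam2 Gam1 Gam3 :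
  mgraph_iso Gam1 Gam2 -> mgraph_iso Gam2 Gam3 -> mgraph_iso Gam1 Gam3.
Proof.
move=> [f [k [bf bk froot fk]]] [f' [k' [bf' bk' froot' fk']]].
exists (f' \o f), (k' \o k); split.
- exact: bij_comp.
- exact: bij_comp.
- by rewrite /= froot.
- move=> e /=; have [-> -> ->] := fk' (k e); by have [-> -> ->] := fk e.
Qed.

Lemma mgraph_iso_dist_le Gam1 Gam2 (f : vertex Gam1 -> vertex Gam2)
    (k : edge Gam1 -> edge Gam2) :
  (forall e, src (k e) = f (src e) /\ tgt (k e) = f (tgt e)) ->
  forall n v w, dist_le v w n -> dist_le (f v) (f w) n.
Proof.
move=> fk n v w [m mn p]; exists m => //; elim: m v {mn} p => [|m IH] v /=.
  by move=> ->.
move=> [u [e [[<- <-]|[<- <-]]] /IH p]; eexists; try exact: p; exists (k e).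
- by left; exact: fk.
- by right; split; apply fk.
Qed.

Lemma mgraph_iso_ball Gam1 Gam2 n :
  mgraph_iso Gam1 Gam2 -> mgraph_iso (ball_graph Gam1 n) (ball_graph Gam2 n).
Proof.
move=> [f [k [[f' fK f'K] [k' kK k'K] froot fk]]].
have st e : src (k e) = f (src e) /\ tgt (k e) = f (tgt e) by have [] := fk e.
have st' e : src (k' e) = f' (src e) /\ tgt (k' e) = f' (tgt e).
  by have [s t] := st (k' e); rewrite k'K in s t; rewrite s t !fK.
have f'root : f' root = root by rewrite -froot fK.
have fb v : dist_le root v n -> dist_le root (f v) n.
  by move/(mgraph_iso_dist_le st); rewrite froot.
have f'b v : dist_le root v n -> dist_le root (f' v) n.
  by move/(mgraph_iso_dist_le st'); rewrite f'root.
have kb e : dist_le root (src e) n /\ dist_le root (tgt e) n ->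
    dist_le root (src (k e)) n /\ dist_le root (tgt (k e)) n.
  by have [-> ->] := st e => -[/fb ? /fb ?].
have k'b e : dist_le root (src e) n /\ dist_le root (tgt e) n ->
    dist_le root (src (k' e)) n /\ dist_le root (tgt (k' e)) n.
  by have [-> ->] := st' e => -[/f'b ? /f'b ?].
exists (fun v => exist _ (f (sval v)) (fb _ (svalP v))),
  (fun e => exist _ (k (sval e)) (kb _ (svalP e))); split.
- exists (fun v => exist _ (f' (sval v)) (f'b _ (svalP v))) => v;
  by apply: eq_sval; rewrite /= ?fK ?f'K.
- exists (fun e => exist _ (k' (sval e)) (k'b _ (svalP e))) => e;
  by apply: eq_sval; rewrite /= ?kK ?k'K.
- exact: eq_sval.
- move=> e; have [s t l] := fk (sval e).
  by split=> //; exact: eq_sval.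
Qed.

End Graphs.

Record clf_mgraph (L : Type) := CLFMGraph {
  clf_graph :> mgraph L;
  clf_connected : connected_graph clf_graph;
  clf_locally_finite : locally_finite clf_graph }.

Section MG0.
Variable L : Type.

HB.instance Definition _ := gen_eqMixin (clf_mgraph L).
HB.instance Definition _ := gen_choiceMixin (clf_mgraph L).

Local Open Scope ring_scope.
Local Open Scope quotient_scope.

Definition isob (Gam1 Gam2 : clf_mgraph L) : bool := `[< mgraph_iso Gam1 Gam2 >].

Lemma isob_refl : reflexive isob.
Proof. by move=> g; apply/asboolP; exact: mgraph_iso_refl. Qed.

Lemma isob_sym : symmetric isob.
Proof. by move=> g h; apply/asboolP/asboolP; exact: mgraph_iso_sym. Qed.

Lemma isob_trans : transitive isob.
Proof.
move=> g h k /asboolP hg /asboolP gk; apply/asboolP; exact: mgraph_iso_trans gk.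
Qed.

Canonical isob_equiv := EquivRel isob isob_refl isob_sym isob_trans.

Definition MG0 : Type := {eq_quot isob}.
HB.instance Definition _ := Choice.on MG0.
HB.instance Definition _ := EqQuotient.on MG0.

Lemma MG0_eqP (Gam1 Gam2 : clf_mgraph L) :
  \pi_MG0 Gam1 = \pi_MG0 Gam2 <-> mgraph_iso Gam1 Gam2.
Proof. by split=> [/eqquotP/asboolP //|i]; apply/eqquotP/asboolP. Qed.

(* This does not depend on the representatives: see [balls_differE]. *)
Definition balls_differ (x y : MG0) (n : nat) : bool :=
  `[< ~ mgraph_iso (ball_graph (repr x) n) (ball_graph (repr y) n) >].

Lemma balls_differE (Gam1 Gam2 : clf_mgraph L) n :
  balls_differ (\pi_MG0 Gam1) (\pi_MG0 Gam2) n <->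
  ~ mgraph_iso (ball_graph Gam1 n) (ball_graph Gam2 n).
Proof.
have rep (Gam : clf_mgraph L) : mgraph_iso (repr (\pi_MG0 Gam)) Gam.
  by apply/MG0_eqP; rewrite reprK.
have b1 := mgraph_iso_ball n (rep Gam1); have b2 := mgraph_iso_ball n (rep Gam2).
split=> [/asboolP nb b|nb]; [apply: nb|apply/asboolP => b; apply: nb].
- exact: mgraph_iso_trans b1 (mgraph_iso_trans b (mgraph_iso_sym b2)).
- exact: mgraph_iso_trans (mgraph_iso_sym b1) (mgraph_iso_trans b b2).
Qed.

(* Connected locally finite graphs all of whose balls about the marked vertex
   are pairwise isomorphic are isomorphic, so the last branch is only reached
   when [x = y]; the values of the metric are rational. *)
Definition delta (x y : MG0) : rat :=
  if pselect (x = y) is left _ then 0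
  else if pselect (exists n, balls_differ x y n) is left ex
       then 2%:R ^- ex_minn ex else 0.

Lemma delta_ge0 x y : 0 <= delta x y.
Proof.
by rewrite /delta; case: pselect => // _; case: pselect.
Qed.

Lemma balls_differxx x n : balls_differ x x n = false.
Proof. by apply/asboolPn; apply; exact: mgraph_iso_refl. Qed.

Lemma delta_lt x y (e : rat) : 0 < e ->
  delta x y < e <-> (forall n, balls_differ x y n -> 2%:R ^- n < e).
Proof.
move=> e0; rewrite /delta; case: pselect => [->|xy].
  by split=> // _ n; rewrite balls_differxx.
case: pselect => [ex|nex]; last by split=> // _ n nb; case: nex; exists n.
case: ex_minnP => m bm minm; split=> [lt n /minm mn|]; last exact.
apply: le_lt_trans lt.
by rewrite lef_pV2 ?posrE ?exprn_gt0// ler_weXn2l// ler1n.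
Qed.

Lemma balls_differ_sym x y n : balls_differ x y n = balls_differ y x n.
Proof.
by apply/asboolP/asboolP => + i; apply; exact: mgraph_iso_sym.
Qed.

Lemma balls_differ_trans y x z n :
  balls_differ x z n -> balls_differ x y n || balls_differ y z n.
Proof.
move=> /asboolP xz; apply: contra_notT xz.
rewrite negb_or => /andP[/asboolPn/contrapT xy /asboolPn/contrapT yz].
exact: mgraph_iso_trans yz.
Qed.

Definition delta_ball (x : MG0) (e : rat) (y : MG0) : Prop := delta x y < e.

Lemma delta_ball_center x e : 0 < e -> delta_ball x e x.
Proof. by move=> e0; apply/delta_lt => // n; rewrite balls_differxx. Qed.

Lemma delta_ball_gt0 x e y : delta_ball x e y -> 0 < e.
Proof. exact/le_lt_trans/delta_ge0. Qed.

Lemma delta_ball_sym x y e : delta_ball x e y -> delta_ball y e x.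
Proof.
move=> xy; have e0 := delta_ball_gt0 xy; apply/delta_lt => // n.
by rewrite balls_differ_sym; move: n; apply/delta_lt.
Qed.

Lemma delta_ball_triangle x y z e1 e2 :
  delta_ball x e1 y -> delta_ball y e2 z -> delta_ball x (e1 + e2) z.
Proof.
move=> xy yz; have e10 := delta_ball_gt0 xy; have e20 := delta_ball_gt0 yz.
apply/delta_lt => [|n /(balls_differ_trans y) /orP[]]; first exact: addr_gt0.
- move/(delta_lt _ _ e10).1 : xy => /[apply] /lt_le_trans; apply.
  by rewrite lerDl ltW.
- move/(delta_lt _ _ e20).1 : yz => /[apply] /lt_le_trans; apply.
  by rewrite lerDr ltW.
Qed.

HB.instance Definition _ :=
  hasNbhs.Build MG0 (nbhs_ (entourage_ delta_ball)).

Let nbhs_deltaE : @nbhs _ MG0 = nbhs_ (entourage_ delta_ball).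
Proof. by []. Qed.

HB.instance Definition _ := Nbhs_isPseudoMetric.Build rat MG0
  nbhs_deltaE delta_ball_center delta_ball_sym delta_ball_triangle erefl.

End MG0.

Record action (G : groupType) (M : Type) := Action {
  act :> G -> M -> M;
  act1 : forall x, act 1%g x = x;
  actM : forall g h x, act (g * h)%g x = act g (act h x) }.

Definition borel (T : ptopologicalType) : measurableType (@open T).-sigma :=
  g_sigma_algebraType (@open T).

Section Actions.
Variables (G : groupType).

Definition act_orbit (M : Type) (A : action G M) (x : M) : set M :=
  [set y | exists g, A g x = y].

Definition invariant_set (M : Type) (A : action G M) (X : set M) : Prop :=
  forall g x, X x -> X (A g x).

Definition minimal_invariant_set (T : topologicalType) (A : action G T)
    (X : set T) : Prop :=
  [/\ X !=set0, closed X, invariant_set A X &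
      forall x, X x -> X `<=` closure (act_orbit A x)].

Definition is_subgroup (H : set G) : Prop :=
  [/\ H 1%g, forall g h, H g -> H h -> H (g * h)%g &
      forall g, H g -> H (g^-1)%g].

Definition generated (S : set G) : set G := smallest is_subgroup S.

Lemma is_subgroup_generated S : is_subgroup (generated S).
Proof.
split=> [H [[]]//|g h gS hS H [sH SH]|g gS H [sH SH]].
  by have [_ + _] := sH; apply; [apply: gS|apply: hS].
by have [_ _ +] := sH; apply; apply: gS.
Qed.

Lemma actK (M : Type) (A : action G M) g x : A (g^-1)%g (A g x) = x.
Proof. by rewrite -actM mulVg act1. Qed.

Lemma actVK (M : Type) (A : action G M) g x : A g (A (g^-1)%g x) = x.
Proof. by rewrite -actM mulgV act1. Qed.

Definition measure_invariant (T : ptopologicalType) (R : realType)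
    (A : action G T) (mu : probability (borel T) R) : Prop :=
  forall g (X : set (borel T)), measurable X -> mu (A g @^-1` X) = mu X.

(* As usual for isomorphisms of measure spaces, the conjugacy is taken up to null
   sets: it is a bijection between invariant Borel sets of full measure. *)
Definition isomorphic_actions (R : realType)
    (T1 : ptopologicalType) (A : action G T1) (D1 : set T1)
    (mu1 : probability (borel T1) R)
    (T2 : ptopologicalType) (B : action G T2) (D2 : set T2)
    (mu2 : probability (borel T2) R) : Prop :=
  exists (X1 : set (borel T1)) (X2 : set (borel T2)) (f : borel T1 -> borel T2),
    [/\ [/\ measurable X1, X1 `<=` D1, invariant_set A X1 & mu1 (~` X1) = 0%E],
        [/\ measurable X2, X2 `<=` D2, invariant_set B X2 & mu2 (~` X2) = 0%E],
        set_bij X1 X2 f /\ (forall g x, X1 x -> f (A g x) = B g (f x)) &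
        [/\ forall Y, measurable Y -> measurable (X1 `&` f @^-1` Y),
            forall Y, measurable Y -> Y `<=` X1 -> measurable (f @` Y) &
            forall Y, measurable Y -> Y `<=` X1 -> mu2 (f @` Y) = mu1 Y]].
End Actions.

(* Vertices of the binary rooted tree are finite words over {0, 1}, with
   [false] for 0 and [true] for 1; the neighbours of a word further from the
   root are obtained by adding a letter at its end. *)
Definition tree_adj (u v : seq bool) : Prop :=
  (exists x, v = rcons u x) \/ (exists x, u = rcons v x).

Record tree_aut := TreeAut {
  ta_fun :> seq bool -> seq bool;
  ta_inv : seq bool -> seq bool;
  ta_funK : cancel ta_fun ta_inv;
  ta_invK : cancel ta_inv ta_fun;
  ta_root : ta_fun [::] = [::];
  ta_adj : forall u v, tree_adj (ta_fun u) (ta_fun v) <-> tree_adj u v }.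

Lemma tree_aut_eq (g h : tree_aut) : g =1 h -> g = h.
Proof.
case: g h => [g g' gK g'K g1 ga] [h h' hK h'K h1 ha] /= gh.
have {}gh : g = h by exact/funext.
have gh' : g' = h' by apply/funext => w; rewrite -[w in RHS]g'K gh hK.
rewrite {}gh {}gh' in gK g'K g1 ga *; congr TreeAut; exact: Prop_irrelevance.
Qed.

HB.instance Definition _ := gen_eqMixin tree_aut.
HB.instance Definition _ := gen_choiceMixin tree_aut.

Section TreeAutGroup.
Implicit Types g h : tree_aut.

Definition ta_one : tree_aut.
Proof. by exists id id. Defined.

Definition ta_mul g h : tree_aut.
Proof.
exists (g \o h) (ta_inv h \o ta_inv g).
- exact: can_comp (@ta_funK g) (@ta_funK h).
- exact: can_comp (@ta_invK h) (@ta_invK g).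
- by rewrite /= !ta_root.
- by move=> u v /=; split=> [/ta_adj/ta_adj//|uv]; exact/ta_adj/ta_adj.
Defined.

Definition ta_opp g : tree_aut.
Proof.
exists (ta_inv g) g.
- exact: ta_invK.
- exact: ta_funK.
- by rewrite -[in LHS](ta_root g) ta_funK.
- by move=> u v; rewrite -[in X in _ <-> X](ta_invK g u)
    -[in X in _ <-> X](ta_invK g v); split=> /ta_adj.
Defined.

Lemma ta_mulA : associative ta_mul.
Proof. by move=> g h k; exact: tree_aut_eq. Qed.
Lemma ta_mul1 : left_id ta_one ta_mul.
Proof. by move=> g; exact: tree_aut_eq. Qed.
Lemma ta_mulr1 : right_id ta_one ta_mul.
Proof. by move=> g; exact: tree_aut_eq. Qed.
Lemma ta_mulV : left_inverse ta_one ta_opp ta_mul.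
Proof. by move=> g; apply: tree_aut_eq => w; exact: ta_funK. Qed.
Lemma ta_mulrV : right_inverse ta_one ta_opp ta_mul.
Proof. by move=> g; apply: tree_aut_eq => w; exact: ta_invK. Qed.
End TreeAutGroup.

HB.instance Definition _ := isGroup.Build tree_aut
  ta_mulA ta_mul1 ta_mulr1 ta_mulV ta_mulrV.

Definition word_a (w : seq bool) : seq bool :=
  if w is x :: w' then ~~ x :: w' else [::].

Fixpoint word_b (w : seq bool) : seq bool :=
  match w with
  | [::] => [::]
  | false :: w' => false :: word_a w'
  | true :: w' => true :: word_c w'
  end
with word_c (w : seq bool) : seq bool :=
  match w with
  | [::] => [::]
  | false :: w' => false :: word_a w'
  | true :: w' => true :: word_d w'
  end
with word_d (w : seq bool) : seq bool :=
  match w with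
  | [::] => [::]
  | false :: w' => false :: w'
  | true :: w' => true :: word_b w'
  end.

Lemma word_aK : involutive word_a.
Proof. by case=> //= x w; rewrite negbK. Qed.

Lemma word_bcdK w :
  [/\ word_b (word_b w) = w, word_c (word_c w) = w & word_d (word_d w) = w].
Proof.
elim: w => //= -[] w [b c d] /=; first by rewrite b c d.
by rewrite word_aK.
Qed.

Lemma tree_adj_cons x u v : tree_adj (x :: u) (x :: v) <-> tree_adj u v.
Proof.
split=> -[] [y]; rewrite -?rcons_cons => e; [left|right|left|right]; exists y.
- by case: e.
- by case: e.
- by rewrite e.
- by rewrite e.
Qed.

Lemma tree_adj_mono (f : seq bool -> seq bool) :
  (forall w x, exists y, f (rcons w x) = rcons (f w) y) ->
  forall u v, tree_adj u v -> tree_adj (f u) (f v).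
Proof.
move=> fP u v [] [x ->].
- by have [y ->] := fP u x; left; exists y.
- by have [y ->] := fP v x; right; exists y.
Qed.

Lemma word_a_rcons w x : exists y, word_a (rcons w x) = rcons (word_a w) y.
Proof. by case: w => [|z w]; [exists (~~ x)|exists x]. Qed.

Lemma word_bcd_rcons w x :
  [/\ exists y, word_b (rcons w x) = rcons (word_b w) y,
      exists y, word_c (rcons w x) = rcons (word_c w) y &
      exists y, word_d (rcons w x) = rcons (word_d w) y].
Proof.
elim: w => [|z w [[b eb] [c ec] [d ed]]].
  by case: x; split; do [by exists true|by exists false].
have [a ea] := word_a_rcons w x.
case: z => /=; rewrite ?eb ?ec ?ed ?ea; split; eexists; by rewrite -rcons_cons.
Qed.

Section Involution.
Variable f : seq bool -> seq bool.
Hypotheses (fK : involutive f) (f0 : f [::] = [::]).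
Hypothesis f_rcons : forall w x, exists y, f (rcons w x) = rcons (f w) y.

Lemma involution_adj u v : tree_adj (f u) (f v) <-> tree_adj u v.
Proof.
split; last exact: tree_adj_mono.
by move/(tree_adj_mono f_rcons); rewrite !fK.
Qed.

Definition involution_aut : tree_aut := TreeAut fK fK f0 involution_adj.
End Involution.

Definition aut_a : tree_aut := involution_aut word_aK erefl word_a_rcons.

Definition aut_b : tree_aut.
Proof.
by refine (@involution_aut word_b _ _ _) => // [w|w x];
  [have [] := word_bcdK w|have [] := word_bcd_rcons w x].
Defined.

Definition aut_c : tree_aut.
Proof.
by refine (@involution_aut word_c _ _ _) => // [w|w x];
  [have [] := word_bcdK w|have [] := word_bcd_rcons w x].
Defined.

Definition aut_d : tree_aut.
Proof.
by refine (@involution_aut word_d _ _ _) => // [w|w x];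
  [have [] := word_bcdK w|have [] := word_bcd_rcons w x].
Defined.

Definition aut_gens : set tree_aut := [set aut_a; aut_b; aut_c; aut_d].

Definition grigorchuk : Type := {g : tree_aut | g \in generated aut_gens}.
HB.instance Definition _ := SubChoice.on grigorchuk.

Lemma grigorchuk_closed :
  group_closed (fun g : tree_aut => g \in generated aut_gens).
Proof.
have [H1 HM HV] := is_subgroup_generated aut_gens.
split=> [|g h gG hG]; first exact: (mem_set H1).
by apply: (mem_set (HM _ _ (set_mem gG) (HV _ (set_mem hG)))).
Qed.

HB.instance Definition _ :=
  SubChoice_isSubGroup.Build tree_aut _ grigorchuk grigorchuk_closed.

Lemma aut_gens_grig g : aut_gens g -> g \in generated aut_gens.
Proof. by move=> gS; apply/mem_set; exact: sub_gen_smallest. Qed.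

Definition grig_a : grigorchuk :=
  Sub aut_a (aut_gens_grig (or_introl (or_introl (or_introl erefl)))).
Definition grig_b : grigorchuk :=
  Sub aut_b (aut_gens_grig (or_introl (or_introl (or_intror erefl)))).
Definition grig_c : grigorchuk :=
  Sub aut_c (aut_gens_grig (or_introl (or_intror erefl))).
Definition grig_d : grigorchuk :=
  Sub aut_d (aut_gens_grig (or_intror erefl)).

Definition grig_gens : set grigorchuk := [set grig_a; grig_b; grig_c; grig_d].

Lemma grig_gens_finite : finite_set grig_gens.
Proof. by rewrite !finite_setU; do ![split]. Qed.

Lemma grig_gens_sym s : grig_gens s -> (s^-1)%g = s.
Proof.
by case=> [[[]|]|] ->; apply/val_inj; rewrite gmulfV; apply: tree_aut_eq.
Qed.

Lemma grig_gens_generate : generated grig_gens = setT.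
Proof.
apply/seteqP; split=> // x _ H [[H1 HM HV] SH].
suff: generated aut_gens `<=` (val @` H).
  by move=> /(_ _ (set_mem (valP x))) [y Hy /val_inj <-].
apply: smallest_sub; first split.
- by exists 1%g => //; exact: gmulf1.
- by move=> _ _ [y Hy <-] [z Hz <-]; exists (y * z)%g; [exact: HM|exact: gmulfM].
- by move=> _ [y Hy <-]; exists (y^-1)%g; [exact: HV|exact: gmulfV].
- move=> _ [[[]|]|] ->; [exists grig_a|exists grig_b|exists grig_c|exists grig_d];
    by [|apply: SH; rewrite /grig_gens/=; do ![by left|by right|left]].
Qed.

Lemma grig_ind (H : set grigorchuk) :
  is_subgroup H -> grig_gens `<=` H -> forall g, H g.
Proof.
move=> sH SH g; have : [set: grigorchuk] g by [].
by rewrite -grig_gens_generate; exact: smallest_sub.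
Qed.

Lemma tree_aut_rcons (g : tree_aut) w x : exists y, g (rcons w x) = rcons (g w) y.
Proof.
elim/last_ind: w x => [|w z IH] x.
  have : tree_adj (g [::]) (g [:: x]) by apply/ta_adj; left; exists x.
  rewrite ta_root => -[[y ->]|[y]]; first by exists y.
  by move/(congr1 size); rewrite size_rcons.
have : tree_adj (g (rcons w z)) (g (rcons (rcons w z) x)).
  by apply/ta_adj; left; exists x.
move=> [[y ->]|[y]]; first by exists y.
have [t ->] := IH z => /rcons_inj[/(can_inj (@ta_funK g))/(congr1 size)].
by rewrite !size_rcons => /eqP; rewrite -addn2 -[X in X == _]addn0 eqn_add2l.
Qed.

(* Infinite words, with the topology of [cantor_space]. *)
Definition boundary : Set := nat -> bool.
HB.instance Definition _ := Choice.copy boundary cantor_space.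
HB.instance Definition _ := Pointed.copy boundary cantor_space.
HB.instance Definition _ := Topological.copy boundary cantor_space.

(* The action induced on infinite words by the action on their finite prefixes
   (see [boundary_act_prefix]); on the generators it is given by the same
   recursive formulas as on finite words ([boundary_act_a] and so on). *)
Definition boundary_act (g : tree_aut) (xi : boundary) : boundary :=
  fun n => nth false (g (mkseq xi n.+1)) n.

Lemma boundary_act_prefix g xi n :
  mkseq (boundary_act g xi) n = g (mkseq xi n).
Proof.
elim: n => [|n IH]; first by rewrite ta_root.
rewrite mkseqS IH /boundary_act mkseqS.
have [y gy] := tree_aut_rcons g (mkseq xi n) (xi n).
by rewrite gy nth_rcons -IH size_mkseq ltnn eqxx.
Qed.

Definition bcons (x : bool) (xi : boundary) : boundary :=
  fun n => if n is m.+1 then xi m else x.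

Lemma mkseq_bcons x xi n : mkseq (bcons x xi) n.+1 = x :: mkseq xi n.
Proof. by rewrite /mkseq /= -[in LHS]add1n iotaDl -map_comp. Qed.

Lemma boundary_act_a x xi : boundary_act aut_a (bcons x xi) = bcons (~~ x) xi.
Proof.
by apply/funext => -[|n]; rewrite /boundary_act mkseq_bcons //= nth_mkseq.
Qed.

Lemma boundary_act_b x xi : boundary_act aut_b (bcons x xi) =
  bcons x (boundary_act (if x then aut_c else aut_a) xi).
Proof.
by apply/funext => -[|n]; rewrite /boundary_act mkseq_bcons; case: x.
Qed.

Lemma boundary_act_c x xi : boundary_act aut_c (bcons x xi) =
  bcons x (boundary_act (if x then aut_d else aut_a) xi).
Proof.
by apply/funext => -[|n]; rewrite /boundary_act mkseq_bcons; case: x.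
Qed.

Lemma boundary_act_d x xi : boundary_act aut_d (bcons x xi) =
  bcons x (if x then boundary_act aut_b xi else xi).
Proof.
by apply/funext => -[|n]; rewrite /boundary_act mkseq_bcons; case: x => //=;
  rewrite nth_mkseq.
Qed.

Lemma boundary_act1 xi : boundary_act (val (1%g : grigorchuk)) xi = xi.
Proof.
by rewrite gmulf1; apply/funext => n; rewrite /boundary_act nth_mkseq.
Qed.

Lemma boundary_actM (g h : grigorchuk) xi :
  boundary_act (val (g * h)%g) xi = boundary_act (val g) (boundary_act (val h) xi).
Proof.
rewrite gmulfM; apply/funext => n.
by rewrite [in RHS]/boundary_act boundary_act_prefix.
Qed.

Definition boundary_action : action grigorchuk boundary :=
  @Action grigorchuk boundary (fun g => boundary_act (val g))
    boundary_act1 boundary_actM.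

Definition cylinder (w : seq bool) : set boundary :=
  [set xi | mkseq xi (size w) = w].

Definition is_uniform_measure (R : realType)
    (mu : probability (borel boundary) R) : Prop :=
  forall w, mu (cylinder w) = ((2^-1 : R) ^+ size w)%:E%R.

Section Schreier.
Variables (M : Type) (A : action grigorchuk M).

Definition schreier_graph (x : M) : mgraph grigorchuk :=
  @MGraph grigorchuk M (M * {s : grigorchuk | grig_gens s})
    (fun e => e.1) (fun e => A (sval e.2) e.1) (fun e => sval e.2) x.
End Schreier.

Section MarkedSchreier.
Variables (M : Type) (A : action grigorchuk M) (x : M).

Definition orbit_type : Type := {y : M | act_orbit A x y}.

Lemma act_orbit_stable (g : grigorchuk) (y : orbit_type) :
  act_orbit A x (A g (sval y)).
Proof. by have [h <-] := svalP y; exists (g * h)%g; rewrite actM. Qed.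

Definition orbit_act (g : grigorchuk) (y : orbit_type) : orbit_type :=
  exist _ (A g (sval y)) (act_orbit_stable g y).

Lemma orbit_act1 y : orbit_act 1%g y = y.
Proof. by apply: eq_sval => /=; exact: act1. Qed.

Lemma orbit_actM g h y : orbit_act (g * h)%g y = orbit_act g (orbit_act h y).
Proof. by apply: eq_sval => /=; exact: actM. Qed.

Definition orbit_action : action grigorchuk orbit_type :=
  Action orbit_act1 orbit_actM.

Lemma act_orbit_refl : act_orbit A x x.
Proof. by exists 1%g; rewrite act1. Qed.

Definition orbit_base : orbit_type := exist _ x act_orbit_refl.
End MarkedSchreier.

Section MarkedSchreierGraph.
Variables (M : Type) (A : action grigorchuk M) (x : M).

Definition marked_schreier_graph : mgraph grigorchuk :=
  schreier_graph (orbit_action A x) (orbit_base A x).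

Lemma schreier_upath (v : vertex marked_schreier_graph) g :
  exists n, upath n v (orbit_action A x g v).
Proof.
move: v; suff : [set g | forall v, exists n,
  @upath _ marked_schreier_graph n v (orbit_action A x g v)] g by [].
move: g; apply: grig_ind; first split.
- by move=> v; exists 0%N; exact: (esym (act1 (orbit_action A x) v)).
- move=> g h pg ph v; have [m hm] := ph v; have [n gn] := pg (orbit_action A x h v).
  by exists (m + n)%N; rewrite actM; exact: upath_cat gn.
- move=> g pg v; have [n gn] := pg (orbit_action A x (g^-1)%g v).
  by exists n; apply: upath_sym; rewrite actVK in gn.
- move=> s sS v; exists 1%N; exists (orbit_action A x s v) => //.
  by exists (v, exist _ s sS); left.
Qed.

Lemma marked_schreier_connected : connected_graph marked_schreier_graph.
Proof.
move=> [v [g gv]] [w [h hw]].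
have [n p] := schreier_upath (exist _ v (ex_intro _ g gv)) (h * g^-1)%g.
exists n; congr (upath n _ _): p; apply: eq_sval => /=.
by rewrite -gv -hw -actM -mulgA mulVg mulg1.
Qed.

Lemma marked_schreier_locally_finite : locally_finite marked_schreier_graph.
Proof.
move=> v.
have finS : finite_set [set: {s | grig_gens s}].
  apply: (@sub_finite_set _ _ (sval @^-1` grig_gens)) => [[s sS] _ //|].
  apply: finite_preimage grig_gens_finite.
  by move=> s t _ _; exact: eq_sval.
apply: (@sub_finite_set _ _
  ((fun s => (v, s)) @` [set: {s | grig_gens s}] `|`
   (fun s => (orbit_action A x ((sval s)^-1)%g v, s)) @` [set: {s | grig_gens s}])).
  move=> [w s] /= [->|<-]; [left|right]; exists s => //.
  by congr pair; exact: (actK (orbit_action A x)).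
by rewrite finite_setU; split; exact: finite_image.
Qed.

Definition marked_schreier_clf : clf_mgraph grigorchuk :=
  CLFMGraph marked_schreier_connected marked_schreier_locally_finite.
End MarkedSchreierGraph.

Local Open Scope quotient_scope.

Definition sch_class (M : Type) (A : action grigorchuk M) (x : M) :
  MG0 grigorchuk := \pi_(MG0 grigorchuk) (marked_schreier_clf A x).

Definition sch_set : set (MG0 grigorchuk) :=
  [set C | exists (M : Type) (A : action grigorchuk M) (x : M), C = sch_class A x].

Definition Sch : Type := set_type sch_set.
HB.instance Definition _ := Topological.on Sch.

Lemma sch_nbhsP (C : Sch) (U : set Sch) :
  nbhs C U <-> exists2 e : rat, (0 < e)%R &
    [set D : Sch | (delta (val C) (val D) < e)%R] `<=` U.
Proof.
split=> [[_ /= [[V oV <-] VC VU]]|[e e0 eU]].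
  have : nbhs (set_val C : MG0 grigorchuk) V by apply: open_nbhs_nbhs; split.
  by move=> /nbhs_ballP[e /= e0 eV]; exists e => // D /eV /VU.
have : nbhs (set_val C : MG0 grigorchuk) (delta_ball (val C) e).
  exact: nbhsx_ballx.
move=> /(@initial_continuous Sch (MG0 grigorchuk) set_val C) nC.
exact: (@filterS _ (nbhs C) _ _ _ eU nC).
Qed.

Lemma sch_class_in (M : Type) (A : action grigorchuk M) (x : M) :
  sch_class A x \in sch_set.
Proof. by apply/mem_set; exists M, A, x. Qed.

Definition marked_schreier (M : Type) (A : action grigorchuk M) (x : M) : Sch :=
  exist _ (sch_class A x) (sch_class_in A x).

Section StabilizersAndIsomorphism.
Variables (M : Type) (A : action grigorchuk M) (N : Type)
  (B : action grigorchuk N) (x : M) (y : N).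

Lemma marked_schreier_stab :
  marked_schreier A x = marked_schreier B y -> forall g, A g x = x <-> B g y = y.
Proof.
move=> /(congr1 val)/MG0_eqP [f [k [[f' fK f'K] _ froot fk]]].
have fact g v : f (orbit_action A x g v) = orbit_action B y g (f v).
  move: v; suff : [set g | forall v,
    f (orbit_action A x g v) = orbit_action B y g (f v)] g by [].
  move: g; apply: grig_ind; first split.
  - by move=> v; rewrite !act1.
  - by move=> g h Eg Eh v; rewrite !actM Eg Eh.
  - by move=> g Eg v; rewrite -{2}(actVK (orbit_action A x) g v) Eg actK.
  - move=> s sS v; have /= [] := fk (v, exist _ s sS).
    by case: (k _) => w [t tS] /= -> <- ->.
move=> g; have {}froot : f (orbit_base A x) = orbit_base B y := froot.
split=> [gx|gy].
- have : orbit_action A x g (orbit_base A x) = orbit_base A x by exact: eq_sval.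
  by move/(congr1 f); rewrite fact froot => /(congr1 sval).
- have : orbit_action B y g (orbit_base B y) = orbit_base B y by exact: eq_sval.
  by rewrite -froot -fact => /(can_inj fK)/(congr1 sval).
Qed.

Lemma eq_stab_act : (forall g, A g x = x <-> B g y = y) ->
  forall g h, A g x = A h x <-> B g y = B h y.
Proof.
move=> xy g h.
have shift (K : Type) (C : action grigorchuk K) z :
    C g z = C h z <-> C (h^-1 * g)%g z = z.
  by rewrite actM; split=> [->|e]; [rewrite actK|rewrite -[in RHS]e actVK].
split=> /shift e; exact/shift/xy.
Qed.
End StabilizersAndIsomorphism.

Section TransportFunction.
Variables (M : Type) (A : action grigorchuk M) (N : Type)
  (B : action grigorchuk N) (x : M) (y : N).
Hypothesis xy : forall g, A g x = x <-> B g y = y.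

Definition orbit_transport (v : orbit_type A x) : orbit_type B y :=
  exist _ (B (sval (cid (svalP v))) y) (ex_intro _ (sval (cid (svalP v))) erefl).

Lemma orbit_transportE g v : sval v = A g x -> sval (orbit_transport v) = B g y.
Proof.
by move=> vg; rewrite /=; case: cid => h /= hv; apply/(eq_stab_act xy); rewrite hv.
Qed.
End TransportFunction.

Lemma orbit_transportK (M : Type) (A : action grigorchuk M) (N : Type)
    (B : action grigorchuk N) (x : M) (y : N)
    (xy : forall g, A g x = x <-> B g y = y) :
  cancel (@orbit_transport _ A _ B x y) (@orbit_transport _ B _ A y x).
Proof.
move=> v; have [g gv] := svalP v.
have yx g' : B g' y = y <-> A g' x = x by split=> /xy.
have e : sval (@orbit_transport _ A _ B x y v) = B g y.
  exact: orbit_transportE (esym gv).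
have := orbit_transportE yx e; rewrite gv.
by move=> ?; exact: eq_sval.
Qed.

Lemma marked_schreier_eqP (M : Type) (A : action grigorchuk M) (N : Type)
    (B : action grigorchuk N) (x : M) (y : N) :
  marked_schreier A x = marked_schreier B y <-> forall g, A g x = x <-> B g y = y.
Proof.
split=> [|xy]; first exact: marked_schreier_stab.
have yx g : B g y = y <-> A g x = x by split=> /xy.
apply: val_inj; apply/MG0_eqP.
pose f := @orbit_transport _ A _ B x y; pose f' := @orbit_transport _ B _ A y x.
have fE g v : sval v = A g x -> sval (f v) = B g y by exact: orbit_transportE.
have fK : cancel f f' := orbit_transportK xy.
have f'K : cancel f' f := orbit_transportK yx.
exists f, (fun e => (f e.1, e.2)); split.
- by exists f'.
- by exists (fun e => (f' e.1, e.2)) => -[v s] /=; rewrite ?fK ?f'K.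
- by apply: eq_sval; rewrite (fE 1%g) ?act1.
- move=> [v s]; split=> //=; apply: eq_sval => /=; have [g gv] := svalP v.
  have /= -> := fE (sval s * g)%g (orbit_action A x (sval s) v) _.
    by have /= -> := fE g v (esym gv); rewrite actM.
  by rewrite /= -gv actM.
Qed.

Lemma sch_act_exists (g : grigorchuk) (C : Sch) :
  exists D : Sch, exists (M : Type) (A : action grigorchuk M) (x : M),
    C = marked_schreier A x /\ D = marked_schreier A (A g x).
Proof.
have [M [A [x Cx]]] := set_mem (valP C).
by exists (marked_schreier A (A g x)), M, A, x; split=> //; exact: val_inj.
Qed.

(* By [sch_actE] this does not depend on the action [A] and the point [x] chosen
   to represent [C] as a marked Schreier graph. *)
Definition sch_act (g : grigorchuk) (C : Sch) : Sch :=
  sval (cid (sch_act_exists g C)).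

Lemma sch_actE g (M : Type) (A : action grigorchuk M) (x : M) :
  sch_act g (marked_schreier A x) = marked_schreier A (A g x).
Proof.
rewrite /sch_act; case: cid => D /= [N [B [y [/marked_schreier_eqP xy ->]]]].
have conj (K : Type) (C : action grigorchuk K) z h :
    C h (C g z) = C g z <-> C (g^-1 * (h * g))%g z = z.
  rewrite !actM; split=> [->|e]; first exact: actK.
  by rewrite -[in RHS]e actVK.
by apply/marked_schreier_eqP => h; split=> /conj/xy/conj.
Qed.

Lemma sch_repr (C : Sch) : exists (M : Type) (A : action grigorchuk M) (x : M),
  C = marked_schreier A x.
Proof.
have [M [A [x Cx]]] := set_mem (valP C).
by exists M, A, x; exact: val_inj.
Qed.

Lemma sch_act1 C : sch_act 1%g C = C.
Proof. by have [M [A [x ->]]] := sch_repr C; rewrite sch_actE act1. Qed.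

Lemma sch_actM g h C : sch_act (g * h)%g C = sch_act g (sch_act h C).
Proof. by have [M [A [x ->]]] := sch_repr C; rewrite !sch_actE actM. Qed.

Definition sch_action : action grigorchuk Sch := Action sch_act1 sch_actM.

Definition boundary_schreier (xi : boundary) : Sch :=
  marked_schreier boundary_action xi.

HB.instance Definition _ :=
  isPointed.Build Sch (boundary_schreier (fun=> false)).

Definition Omega : set Sch :=
  closure (range boundary_schreier) `\` isolated (closure (range boundary_schreier)).

Definition supported_on (T : ptopologicalType) (R : realType)
    (mu : probability (borel T) R) (X : set T) : Prop :=
  mu (~` X) = 0%E.

(* Main.v *)
(* The stabilizer of the marked vertex identifies a marked Schreier graph with a
   subgroup of the group, and the metric topology with pointwise convergence of
   subgroups.  For a point [xi] of the boundary let [N] be the subgroup of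
   elements acting trivially near [xi].  Since the group contains, for every
   vertex of the tree, an element moving exactly the boundary points below that
   vertex, [xi] can be read off, continuously, from any subgroup [H] with
   [N <= H <= Stab xi]; all graphs in the closure of the image of [F] are of this
   form.  Outside the orbit of [1^oo] one has [N = Stab xi], so the fibre over
   [xi] is [F xi].  At [1^oo] the quotient [Stab xi / N] is the Klein group
   [{1, b, c, d}]: near [1^oo] exactly one of [b], [c], [d] fixes the point
   [1^m 0 ...], depending on [m] modulo 3, so the limits of [F] at [1^oo] are the
   three intermediate subgroups of order two, while [F 1^oo] is isolated because
   no other [F xi] is fixed by all of [b], [c], [d].  The orbit of [1^oo] being
   countable, [F] is an isomorphism almost everywhere, and level transitivity of
   the action forces an invariant measure to be uniform on cylinders. *)
Require Import Defs.
From HB Require Import structures.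
From mathcomp Require Import all_boot all_order all_algebra.
From mathcomp Require Import all_classical all_reals all_analysis.
From mathcomp Require Import measurable_realfun zify lra.

Set Implicit Arguments.
Unset Strict Implicit.
Unset Printing Implicit Defensive.

Import Order.TTheory GRing.Theory Num.Theory.
Local Open Scope classical_set_scope.

Local Notation B := boundary_action.
(* [root] is also the name of a predicate on polynomials. *)
Local Notation mroot := Defs.root.
Local Arguments act : simpl never.

(** * Germs and branching of the Grigorchuk group *)

Lemma act_a x xi : B grig_a (bcons x xi) = bcons (~~ x) xi.
Proof. exact: boundary_act_a. Qed.

Lemma act_b x xi :
  B grig_b (bcons x xi) = bcons x (B (if x then grig_c else grig_a) xi).
Proof. by case: x; exact: boundary_act_b. Qed.

Lemma act_c x xi :
  B grig_c (bcons x xi) = bcons x (B (if x then grig_d else grig_a) xi).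
Proof. by case: x; exact: boundary_act_c. Qed.

Lemma act_d x xi :
  B grig_d (bcons x xi) = bcons x (B (if x then grig_b else 1%g) xi).
Proof. by case: x; rewrite ?act1; exact: boundary_act_d. Qed.

Lemma mkseq_act g xi n : mkseq (B g xi) n = val g (mkseq xi n).
Proof. exact: boundary_act_prefix. Qed.

Lemma bcons_inj x y xi zeta : bcons x xi = bcons y zeta -> x = y /\ xi = zeta.
Proof.
move=> e; split; first by have := congr1 (fun f => f 0%N) e.
by apply/funext => n; have := congr1 (fun f => f n.+1) e.
Qed.

Lemma bconsE (xi : boundary) : xi = bcons (xi 0%N) (fun n => xi n.+1).
Proof. by apply/funext => -[]. Qed.

Definition wcat (w : seq bool) (xi : boundary) : boundary := foldr bcons xi w.

Lemma mkseq_wcat w xi : mkseq (wcat w xi) (size w) = w.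
Proof. by elim: w => //= x w IH; rewrite mkseq_bcons IH. Qed.

Lemma wcat_inj v w xi zeta : size v = size w -> wcat v xi = wcat w zeta ->
  v = w /\ xi = zeta.
Proof.
elim: v w => [|x v IH] [|y w] //= [e] /bcons_inj [-> /(IH _ e)].
by case=> -> ->.
Qed.

Lemma wcat_mkseq (xi : boundary) n : wcat (mkseq xi n) (fun m => xi (n + m)%N) = xi.
Proof.
elim: n xi => [|n IH] xi; first by apply/funext.
by rewrite (bconsE xi) mkseq_bcons /= -[in RHS](IH (fun n => xi n.+1)).
Qed.

Lemma mkseq_eqP n (xi zeta : boundary) :
  mkseq xi n = mkseq zeta n <-> forall i, (i < n)%N -> xi i = zeta i.
Proof.
split=> [e i lin|h].
  by rewrite -(nth_mkseq false xi lin) e nth_mkseq.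
by apply: (@eq_from_nth _ false); rewrite !size_mkseq // => i lin; rewrite !nth_mkseq // h.
Qed.

Lemma mkseq_le m n (xi zeta : boundary) : (m <= n)%N ->
  mkseq xi n = mkseq zeta n -> mkseq xi m = mkseq zeta m.
Proof.
by move=> mn /mkseq_eqP e; apply/mkseq_eqP => i im; apply: e; exact: leq_trans mn.
Qed.

Lemma boundary_neqP (xi zeta : boundary) :
  xi <> zeta -> exists n, mkseq xi n <> mkseq zeta n.
Proof.
move=> ne; apply: contrapT => /forallNP h; apply: ne; apply/funext => n.
by have /contrapT/mkseq_eqP -> := h n.+1.
Qed.

Lemma word_bcd w : [/\ word_b (word_c w) = word_d w,
  word_c (word_d w) = word_b w & word_d (word_b w) = word_c w].
Proof.
by elim: w => [|[] w [e1 e2 e3]] //=; rewrite ?e1 ?e2 ?e3 ?word_aK.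
Qed.

Lemma grig_aa : (grig_a * grig_a = 1)%g.
Proof. by apply/val_inj/tree_aut_eq => w; rewrite gmulfM gmulf1; exact: word_aK. Qed.

Lemma grig_bb : (grig_b * grig_b = 1)%g.
Proof.
by apply/val_inj/tree_aut_eq => w; rewrite gmulfM gmulf1; have [] := word_bcdK w.
Qed.

Lemma grig_cc : (grig_c * grig_c = 1)%g.
Proof.
by apply/val_inj/tree_aut_eq => w; rewrite gmulfM gmulf1; have [] := word_bcdK w.
Qed.

Lemma grig_dd : (grig_d * grig_d = 1)%g.
Proof.
by apply/val_inj/tree_aut_eq => w; rewrite gmulfM gmulf1; have [] := word_bcdK w.
Qed.

Lemma grig_bc : (grig_b * grig_c = grig_d)%g.
Proof. by apply/val_inj/tree_aut_eq => w; rewrite gmulfM; have [] := word_bcd w. Qed.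

Lemma grig_cd : (grig_c * grig_d = grig_b)%g.
Proof. by apply/val_inj/tree_aut_eq => w; rewrite gmulfM; have [] := word_bcd w. Qed.

Lemma grig_db : (grig_d * grig_b = grig_c)%g.
Proof. by apply/val_inj/tree_aut_eq => w; rewrite gmulfM; have [] := word_bcd w. Qed.

Lemma grig_gensP s :
  grig_gens s <-> [\/ s = grig_a, s = grig_b, s = grig_c | s = grig_d].
Proof.
rewrite /grig_gens /=; split.
- by case=> [[[]|]|] ->; [exact: Or41|exact: Or42|exact: Or43|exact: Or44].
- by case=> ->; [left; left; left|left; left; right|left; right|right].
Qed.

Lemma grig_invb : (grig_b^-1 = grig_b)%g.
Proof. by apply/grig_gens_sym/grig_gensP; exact: Or42. Qed.
Lemma grig_invc : (grig_c^-1 = grig_c)%g.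
Proof. by apply/grig_gens_sym/grig_gensP; exact: Or43. Qed.
Lemma grig_invd : (grig_d^-1 = grig_d)%g.
Proof. by apply/grig_gens_sym/grig_gensP; exact: Or44. Qed.

Lemma grig_cb : (grig_c * grig_b = grig_d)%g.
Proof. by rewrite -[grig_d]grig_invd -grig_bc invgM grig_invb grig_invc. Qed.
Lemma grig_dc : (grig_d * grig_c = grig_b)%g.
Proof. by rewrite -[grig_b]grig_invb -grig_cd invgM grig_invd grig_invc. Qed.
Lemma grig_bd : (grig_b * grig_d = grig_c)%g.
Proof. by rewrite -[grig_c]grig_invc -grig_db invgM grig_invd grig_invb. Qed.

(** The nucleus of the self-similar group without [a], whose sections at both letters are trivial;
    what remains is a Klein four-group. *)
Definition nucleus : set grigorchuk := [set 1%g; grig_b; grig_c; grig_d].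

Lemma nucleusP k : nucleus k <-> [\/ k = 1%g, k = grig_b, k = grig_c | k = grig_d].
Proof.
rewrite /nucleus /=; split.
- by case=> [[[]|]|] ->; [exact: Or41|exact: Or42|exact: Or43|exact: Or44].
- by case=> ->; [left; left; left|left; left; right|left; right|right].
Qed.

Lemma nucleus_mul k l : nucleus k -> nucleus l -> nucleus (k * l)%g.
Proof.
move=> /nucleusP + /nucleusP; move=> [] -> [] ->; apply/nucleusP;
  rewrite ?mulg1 ?mul1g ?grig_bb ?grig_cc ?grig_dd ?grig_bc ?grig_cb ?grig_bd
    ?grig_db ?grig_cd ?grig_dc;
  by [exact: Or41|exact: Or42|exact: Or43|exact: Or44].
Qed.

Lemma nucleus_sym k : nucleus k -> (k^-1 = k)%g.
Proof.
by move=> /nucleusP[] ->; rewrite ?invg1 ?grig_invb ?grig_invc ?grig_invd.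
Qed.

(** Taking the section at the letter 1 permutes the nucleus: [b] goes to [c], [c] to [d] and [d] to
    [b]. The lemma after this one inverts that permutation. *)
Lemma nucleus_true k : nucleus k -> exists2 l, nucleus l &
  forall zeta, B k (bcons true zeta) = bcons true (B l zeta).
Proof.
move=> /nucleusP[] ->; [exists 1%g|exists grig_c|exists grig_d|exists grig_b];
  try (by move=> z; rewrite ?act_b ?act_c ?act_d ?act1);
  by apply/nucleusP; do [exact: Or41|exact: Or42|exact: Or43|exact: Or44].
Qed.

Lemma nucleus_true_inv l : nucleus l -> exists2 k, nucleus k &
  forall zeta, B k (bcons true zeta) = bcons true (B l zeta).
Proof.
move=> /nucleusP[] ->; [exists 1%g|exists grig_d|exists grig_b|exists grig_c];
  try (by move=> z; rewrite ?act_b ?act_c ?act_d ?act1);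
  by apply/nucleusP; do [exact: Or41|exact: Or42|exact: Or43|exact: Or44].
Qed.

(** After a letter 0 an element of the nucleus continues as [a] or as the identity, so its action
    ends at the next letter. *)
Lemma nucleus_false k x : nucleus k -> exists y, forall zeta,
  B k (bcons false (bcons x zeta)) = bcons false (bcons y zeta).
Proof.
move=> /nucleusP[] ->; [exists x|exists (~~ x)|exists (~~ x)|exists x] => z;
  by rewrite ?act_b ?act_c ?act_d ?act1 ?act_a.
Qed.

(** The section of [g] at the vertex [w], as a relation: sections need not be constructed as
    elements of the group, and the image of [w] is recovered by [sect_mkseq]. *)
Definition sect g w k := exists2 v, size v = size w &
  forall zeta, B g (wcat w zeta) = wcat v (B k zeta).

Lemma sect_mkseq g xi n k : sect g (mkseq xi n) k ->
  forall zeta, B g (wcat (mkseq xi n) zeta) = wcat (mkseq (B g xi) n) (B k zeta).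
Proof.
move=> [v sv h] zeta; have := h (fun m => xi (n + m)%N).
rewrite wcat_mkseq -{1}(wcat_mkseq (B g xi) n) => /wcat_inj.
by rewrite sv !size_mkseq => /(_ erefl) [-> _]; exact: h.
Qed.

Lemma sect1 w : sect 1%g w 1%g.
Proof. by exists w => // z; rewrite !act1. Qed.

Lemma sect_cons g h x y w k :
  (forall zeta, B g (bcons x zeta) = bcons y (B h zeta)) ->
  sect h w k -> sect g (x :: w) k.
Proof. by move=> gh [v sv hv]; exists (y :: v) => [|z]; rewrite /= ?sv ?gh ?hv. Qed.

Lemma nucleus_sect_true n k : nucleus k -> exists2 l, nucleus l & sect k (nseq n true) l.
Proof.
elim: n k => [|n IH] k nk; first by exists k => //; exists [::].
have [l nl klein] := nucleus_true nk; have [l' nl' ll'] := IH _ nl.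
by exists l' => //; exact: sect_cons ll'.
Qed.

Lemma nucleus_sect_false m k x w : nucleus k -> sect k (nseq m true ++ [:: false, x & w]) 1%g.
Proof.
elim: m k => [|m IH] k nk.
  have [y ky] := nucleus_false x nk; exists [:: false, y & w] => // z.
  by rewrite act1 /= ky.
have [l nl klein] := nucleus_true nk; exact: sect_cons (IH l nl).
Qed.

Definition ones : boundary := fun=> true.

Lemma wcat_ones n : wcat (nseq n true) ones = ones.
Proof. by elim: n => //= n ->; apply/funext => -[]. Qed.

Lemma mkseq_ones n : mkseq ones n = nseq n true.
Proof. by rewrite -(wcat_ones n) -[in X in mkseq _ X](size_nseq n true) mkseq_wcat. Qed.

Lemma onesVzero xi :
  xi = ones \/ exists m zeta, xi = wcat (nseq m true) (bcons false zeta).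
Proof.
have [ex|/forallNP h] := pselect (exists n, ~~ xi n); [right|left]; last first.
  by apply/funext => n; have /negP/negPn := h n.
case: (ex_minnP ex) => m xm minm; exists m, (fun i => xi (m + i.+1)%N).
have -> : nseq m true = mkseq xi m.
  rewrite -mkseq_ones; apply/mkseq_eqP => i im.
  by apply/esym; apply: contraTT im => /minm; rewrite -leqNgt.
rewrite -[LHS](wcat_mkseq xi m) [X in wcat _ X = _]bconsE addn0.
by rewrite (negbTE xm).
Qed.

Lemma bcons_ones : bcons true ones = ones.
Proof. by apply/funext => -[]. Qed.

Lemma nucleus_ones k : nucleus k -> B k ones = ones.
Proof.
move=> nk; apply: contrapT => /boundary_neqP[n]; apply.
elim: n k nk => [|n IH] k nk //.
have [l nl klein] := nucleus_true nk.
by rewrite -bcons_ones klein !mkseq_bcons IH.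
Qed.

Definition ones_orbit : set boundary := act_orbit B ones.

Lemma ones_orbit_act g xi : ones_orbit xi <-> ones_orbit (B g xi).
Proof.
split=> -[h hx]; first by exists (g * h)%g; rewrite actM hx.
by exists (g^-1 * h)%g; rewrite actM hx actK.
Qed.

(* A germ of an element of the group is a germ of [1], [b], [c] or [d] after a
   change of prefix; away from the orbit of [1^oo] it is a germ of [1]. *)
Lemma germ g xi : exists n0, forall n, (n0 <= n)%N ->
  exists k, [/\ nucleus k, ~ ones_orbit xi -> k = 1%g & sect g (mkseq xi n) k].
Proof.
have n1 : nucleus 1%g by apply/nucleusP; exact: Or41.
move: g xi; suff : forall g, [set g | forall xi, exists n0, forall n, (n0 <= n)%N ->
  exists k, [/\ nucleus k, ~ ones_orbit xi -> k = 1%g & sect g (mkseq xi n) k]] g by [].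
apply: grig_ind; first split.
- move=> xi; exists 0%N => n _; exists 1%g; split=> //; exact: sect1.
- move=> g h pg ph xi; have [n1' h1] := ph xi; have [n2' h2] := pg (B h xi).
  exists (maxn n1' n2') => n; rewrite geq_max => /andP[/h1[k [nk k1 hk]] /h2[l [nl l1 hl]]].
  exists (l * k)%g; split; first exact: nucleus_mul.
    by move=> nO; rewrite k1 // l1 ?mulg1 // -ones_orbit_act.
  exists (mkseq (B g (B h xi)) n) => [|z]; first by rewrite !size_mkseq.
  by rewrite !actM (sect_mkseq hk) (sect_mkseq hl).
- move=> g pg xi; have [n0 h0] := pg (B g^-1%g xi).
  (* The section of the inverse is the inverse of [k], which is [k] again because the nucleus
     consists of involutions. *)
  exists n0 => n /h0[k [nk k1 hk]]; exists k; split=> //.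
    by move=> nO; apply: k1; rewrite -ones_orbit_act.
  exists (mkseq (B g^-1%g xi) n) => [|z]; first by rewrite !size_mkseq.
  apply: (can_inj (actK B g)); rewrite actVK (sect_mkseq hk) actVK.
  by rewrite -{2}(nucleus_sym nk) actVK.
- move=> s /grig_gensP sS xi.
  have [sa|ns] : s = grig_a \/ nucleus s.
    by case: sS => ->; [left|right; apply/nucleusP; exact: Or42
      |right; apply/nucleusP; exact: Or43|right; apply/nucleusP; exact: Or44].
    exists 1%N => -[//|n] _; exists 1%g; split=> //; rewrite (bconsE xi) mkseq_bcons sa.
    by apply: sect_cons (sect1 _) => z; rewrite act_a act1.
  have [->|[m [z xz]]] := onesVzero xi.
    exists 0%N => n _; rewrite mkseq_ones.
    have [l nl sl] := nucleus_sect_true n ns; exists l; split=> // -[].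
    exact: act_orbit_refl.
  (* The first 0 comes after [m] ones, and one further letter may still be flipped; beyond [m.+2]
     letters the section is trivial. *)
  exists m.+2 => n mn; exists 1%g; split=> //.
  rewrite xz (bconsE z) -(subnKC mn).
  have -> : forall y t p, mkseq (wcat (nseq m true) (bcons false (bcons y t))) (m.+2 + p)
      = nseq m true ++ [:: false, y & mkseq t p].
    elim: (m) => [|m' IH] y t p; first by rewrite !mkseq_bcons.
    by rewrite addSn /= mkseq_bcons IH.
  exact: nucleus_sect_false.
Qed.

(** Away from the orbit of 1^oo the section in [germ] is 1, so the stabilizer of [xi] equals the
    neighbourhood stabilizer. *)
Lemma act_trivial_near g xi : ~ ones_orbit xi -> B g xi = xi ->
  exists n, forall zeta, mkseq zeta n = mkseq xi n -> B g zeta = zeta.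
Proof.
move=> nO gx; have [n /(_ _ (leqnn n))[k [_ /(_ nO) -> /sect_mkseq]]] := germ g xi.
rewrite gx => gn; exists n => zeta zn.
by rewrite -(wcat_mkseq zeta n) zn gn act1.
Qed.

Lemma act_near_ones g : B g ones = ones -> exists k n, nucleus k /\
  forall zeta, mkseq zeta n = mkseq ones n -> B g zeta = B k zeta.
Proof.
move=> g1; have [n /(_ _ (leqnn n))[k [nk _ /sect_mkseq]]] := germ g ones.
rewrite g1 => gn.
(* On the cylinder of [n] ones [g] acts as [k] behind these ones. Inverting the permutation of the
   nucleus [n] times gives the element [l] of the nucleus with this same action. *)
have [l nl ln] : exists2 l, nucleus l &
    forall zeta, B l (wcat (mkseq ones n) zeta) = wcat (mkseq ones n) (B k zeta).
  rewrite mkseq_ones; elim: n {gn} => [|n [l nl ln]]; first by exists k.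
  have [l' nl' ll'] := nucleus_true_inv nl; exists l' => // z /=.
  by rewrite ll' ln.
exists l, n; split=> // zeta zn.
by rewrite -(wcat_mkseq zeta n) zn gn ln.
Qed.

(** An element of the group changes a finite prefix and then acts by the nucleus, which fixes
    1^oo. *)
Lemma ones_orbit_eventually xi : ones_orbit xi -> exists n, forall i, (n <= i)%N -> xi i.
Proof.
move=> [g <-]; have [n /(_ _ (leqnn n))[k [nk _ /sect_mkseq/(_ ones)]]] := germ g ones.
rewrite mkseq_ones wcat_ones (nucleus_ones nk) => ->; exists n => i.
have := size_mkseq (B g ones) n; move: (mkseq _ n) => w; elim: w n i => [|x w IH] n i /=.
  by [].
by move=> <-; case: i => // i; exact: (IH _ i erefl).
Qed.

(** The points 1^m 0^oo converge to 1^oo from outside its orbit, with [m] modulo 3 under control. *)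
Definition zpoint m : boundary := wcat (nseq m true) (fun=> false).

Lemma zpoint_not_orbit m : ~ ones_orbit (zpoint m).
Proof.
move=> /ones_orbit_eventually[n]; apply/existsNP; exists (m + n)%N.
by move=> /(_ (leq_addl _ _)); elim: m.
Qed.

Lemma zpointE m : zpoint m = wcat (nseq m true) (bcons false (fun=> false)).
Proof. by rewrite /zpoint [X in wcat _ X]bconsE. Qed.

Lemma mkseq_zpoint m n : (n <= m)%N -> mkseq (zpoint m) n = mkseq ones n.
Proof.
move=> nm; apply: (mkseq_le nm).
by rewrite mkseq_ones -{2}(size_nseq m true) mkseq_wcat.
Qed.

Lemma act_a_neq xi : B grig_a xi <> xi.
Proof. by rewrite (bconsE xi) act_a => /bcons_inj[]; case: (xi 0%N). Qed.

(** The order [d], [c], [b] makes [klein i] the element that fixes 1^m 0... when [m] is congruent to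
    [i] modulo 3; the default value 1 still lies in the nucleus. *)
Definition klein (i : nat) : grigorchuk := nth 1%g [:: grig_d; grig_c; grig_b] i.

Lemma klein_nucleus i : nucleus (klein i).
Proof.
by apply/nucleusP; case: i => [|[|[|i]]];
  do [exact: Or44|exact: Or43|exact: Or42|rewrite /klein nth_default//; exact: Or41].
Qed.

Lemma nucleus_klein k : nucleus k -> k = 1%g \/ exists2 i, (i < 3)%N & k = klein i.
Proof. by move/nucleusP => [] ->; [left|right; exists 2|right; exists 1|right; exists 0]. Qed.

(** Removing a leading 1 replaces [klein i] by [klein (i - 1)], indices modulo 3. At a leading 0 the
    element [d] is trivial, while [b] and [c] continue as [a], which has no fixed point. *)
Lemma klein_fix i m zeta : (i < 3)%N ->
  B (klein i) (wcat (nseq m true) (bcons false zeta)) =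
    wcat (nseq m true) (bcons false zeta) <-> m = i %[mod 3].
Proof.
elim: m i => [|m IH] i i3 /=.
  have na : bcons false (B grig_a zeta) = bcons false zeta -> False.
    by move=> /bcons_inj[_]; exact: act_a_neq.
  by case: i i3 => [|[|[|]]] // _; rewrite /klein /= ?act_b ?act_c ?act_d ?act1;
    split=> //; by move/na.
have inj x y : bcons true x = bcons true y <-> x = y.
  by split=> [/bcons_inj[]//|->].
case: i i3 => [|[|[|]]] // _; rewrite /klein /= ?act_b ?act_c ?act_d inj.
- by apply: (iff_trans (IH 2 isT)); lia.
- by apply: (iff_trans (IH 0 isT)); lia.
- by apply: (iff_trans (IH 1 isT)); lia.
Qed.

(** * Self-replication, level transitivity and branching *)

Lemma section_lift (g : grigorchuk) x : exists h y : grigorchuk, forall zeta,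
  B h (bcons x zeta) = bcons x (B g zeta) /\
  B h (bcons (~~ x) zeta) = bcons (~~ x) (B y zeta).
Proof.
(* Conjugation by [a] exchanges the two subtrees. *)
wlog -> : x / x = true.
  case: x => [|/(_ true erefl)[h [y hy]]]; first exact.
  exists (grig_a * h * grig_a)%g, y => z; have [h1 h2] := hy z.
  by rewrite !actM !act_a h1 h2 !act_a.
move: g; suff : forall g, [set g | exists h y : grigorchuk, forall zeta,
  B h (bcons true zeta) = bcons true (B g zeta) /\
  B h (bcons false zeta) = bcons false (B y zeta)] g by [].
apply: grig_ind; first split.
- by exists 1%g, 1%g => z; rewrite !act1.
- move=> g1 g2 [h1 [y1 e1]] [h2 [y2 e2]]; exists (h1 * h2)%g, (y1 * y2)%g => z.
  rewrite !actM; have [-> ->] := e2 z; have [-> _] := e1 (B g2 z).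
  by have [_ ->] := e1 (B y2 z).
- move=> g [h [y e]]; exists h^-1%g, y^-1%g => z.
  by split; apply: (can_inj (actK B h)); rewrite actVK;
    have [e1 _] := e (B g^-1%g z); have [_ e2] := e (B y^-1%g z);
    rewrite ?e1 ?e2 actVK.
(* The sections at the letter 1 of [aba], [d], [b], [c] are [a], [b], [c], [d] respectively. *)
- move=> s /grig_gensP[] ->; [exists (grig_a * grig_b * grig_a)%g, grig_c
    |exists grig_d, 1%g|exists grig_b, grig_a|exists grig_c, grig_a] => z;
    by rewrite ?actM ?act_a ?act_b ?act_c ?act_d ?act_a ?act1.
Qed.

Lemma level_transitive (v w : seq bool) : size v = size w ->
  exists g : grigorchuk, forall xi, cylinder v xi <-> cylinder w (B g xi).
Proof.
(* Any word can be carried to the word of ones: [a] corrects a leading 0, then a lift of the element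
   found for the tail acts below the letter 1. Two words of one level are joined through this common
   image. *)
have ones v' : exists g : grigorchuk, forall z, exists z',
    B g (wcat v' z) = wcat (nseq (size v') true) z'.
  elim: v' => [|x v' [g gv]]; first by exists 1%g => z; exists z; rewrite act1.
  have [h [y hy]] := section_lift g true.
  exists (if x then h else h * grig_a)%g => z; have [z' gz] := gv z.
  by case: x; exists z'; rewrite ?actM /= ?act_a; have [-> _] := hy (wcat v' z);
    rewrite gz.
have val_ones v' : exists g : grigorchuk, val g v' = nseq (size v') true.
  have [g gv] := ones v'; exists g; have [z' e] := gv (fun=> true).
  have := congr1 (fun x : boundary => mkseq x (size v')) e; cbv beta.
  rewrite mkseq_act mkseq_wcat => ->.
  by rewrite -{2}(size_nseq (size v') true) mkseq_wcat.
have [g gv] := val_ones v; have [h hw] := val_ones w => vw.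
exists (h^-1 * g)%g => xi.
rewrite /cylinder/= -vw !mkseq_act.
have -> : val (h^-1 * g)%g (mkseq xi (size v)) = w <-> val g (mkseq xi (size v)) = val h w.
  rewrite -!mkseq_act; split=> [<-|e]; first by rewrite -mkseq_act actM actVK.
  rewrite actM mkseq_act e.
  by rewrite gmulfV; exact: ta_funK.
rewrite hw -vw -gv; split=> [->//|].
exact: (can_inj (ta_funK (val g))).
Qed.

(* The normal closure of [(ab)^2], over which the group is regularly branch. *)
Inductive branch : grigorchuk -> Prop :=
| branch_abab : branch (grig_a * grig_b * grig_a * grig_b)%g
| branchM g h : branch g -> branch h -> branch (g * h)%g
| branchV g : branch g -> branch g^-1%g
| branchJ g h : branch g -> branch (h * g * h^-1)%g.

(** The regular branch property: a copy of the subgroup acting on one subtree alone lies in the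
    subgroup itself. Induction over normal generation reduces it to [abab]. *)
Lemma branch_lift (g : grigorchuk) x : branch g -> exists2 h, branch h &
  forall zeta, B h (bcons x zeta) = bcons x (B g zeta) /\
    B h (bcons (~~ x) zeta) = bcons (~~ x) zeta.
Proof.
move=> gK; elim: gK x => {g} [|g1 g2 _ IH1 _ IH2|g _ IH|g k _ IH] x.
- pose k := (grig_a * grig_b * grig_a * grig_b)%g.
  (* This product of conjugates of the inverse of [abab] equals [(b * ada)^2], whose sections are
     [abab] at 0 and [cc = 1] at 1. *)
  pose e := (k^-1 * ((grig_a * grig_d) * k^-1 * (grig_a * grig_d)^-1))%g.
  have Ke : branch e.
    by apply: branchM; [|apply: branchJ]; apply: branchV; exact: branch_abab.
  have eE : e = (grig_b * (grig_a * (grig_d * (grig_a * (grig_b * (grig_a *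
     (grig_d * grig_a)))))))%g.
    have aV : (grig_a^-1 = grig_a)%g by apply/grig_gens_sym/grig_gensP; exact: Or41.
    rewrite /e /k !invgM aV grig_invb grig_invd -!mulgA.
    rewrite [(grig_a * (grig_a * _))%g]mulgA grig_aa mul1g.
    rewrite [(grig_b * (grig_d * _))%g]mulgA grig_bd.
    by rewrite [(grig_c * (grig_b * _))%g]mulgA grig_cb.
  exists (if x then grig_a * e * grig_a^-1 else e)%g; first by case: x => //; exact: branchJ.
  have aV : (grig_a^-1 = grig_a)%g by apply/grig_gens_sym/grig_gensP; exact: Or41.
  move=> z; rewrite eE aV; case: x => /=;
    by rewrite !actM; do ?[rewrite ?act_a /=; rewrite ?act_b ?act_d /= ?act1];
      rewrite -?actM ?grig_cc ?act1.
- have [h1 K1 e1] := IH1 x; have [h2 K2 e2] := IH2 x.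
  exists (h1 * h2)%g; first exact: branchM.
  by move=> z; rewrite !actM; have [-> ->] := e2 z; split;
    [case: (e1 (B g2 z))|case: (e1 z)].
- have [h K e] := IH x; exists h^-1%g; first exact: branchV.
  by move=> z; split; apply: (can_inj (actK B h)); rewrite actVK;
    have [e1 _] := e (B g^-1%g z); have [_ e2] := e z; rewrite ?e1 ?actVK ?e2.
(* The conjugator lifts to [l] with an uncontrolled section [y] on the other subtree; there [h] is
   trivial, so [y] cancels. *)
- have [h K e] := IH x; have [l [y ly]] := section_lift k x.
  exists (l * h * l^-1)%g; first exact: branchJ.
  have lV z : B l^-1%g (bcons x z) = bcons x (B k^-1%g z) /\
     B l^-1%g (bcons (~~ x) z) = bcons (~~ x) (B y^-1%g z).
    by split; apply: (can_inj (actK B l)); rewrite actVK;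
      have [e1 _] := ly (B k^-1%g z); have [_ e2] := ly (B y^-1%g z);
      rewrite ?e1 ?e2 actVK.
  move=> z; rewrite !actM; have [-> ->] := lV z.
  have [-> _] := e (B k^-1%g z); have [_ ->] := e (B y^-1%g z).
  have [-> _] := ly (B g (B k^-1%g z)); have [_ ->] := ly (B y^-1%g z).
  by rewrite actVK.
Qed.

(** [abab] flips the second letter of every point, so it serves for the empty word; [branch_lift]
    pushes it down to the subtree below [v] while leaving all other points fixed. *)
Lemma cylinder_mover v : exists t : grigorchuk, forall xi,
  B t xi = xi <-> mkseq xi (size v) <> v.
Proof.
suff [t _ tv] : exists2 t, branch t & forall xi, B t xi = xi <-> mkseq xi (size v) <> v.
  by exists t.
elim: v => [|x v [t Kt tv]].
  exists (grig_a * grig_b * grig_a * grig_b)%g; first exact: branch_abab.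
  move=> xi; split=> //; rewrite (bconsE xi) (bconsE (fun n => xi n.+1)) !actM.
  case: (xi 0%N); case: (xi 1%N);
    do ?[rewrite ?act_a /=; rewrite ?act_b ?act_c ?act_d /= ?act1];
    by move=> /bcons_inj[_ /bcons_inj[]].
have [h Kh hv] := branch_lift x Kt; exists h => // xi.
rewrite (bconsE xi) mkseq_bcons; set z := fun n => _.
have [->|xv] := eqVneq (xi 0%N) x.
  have [-> _] := hv z; split=> [/bcons_inj[_ /tv ne] []//|ne].
  by congr bcons; apply/tv => e; apply: ne; rewrite e.
have -> : xi 0%N = ~~ x by move: xv; case: (xi 0%N); case: (x).
have [_ ->] := hv z; split=> // _ [].
by case: x {hv xv}.
Qed.

(** * Schreier graphs as stabilizers *)

Fixpoint word_ball (n : nat) : seq grigorchuk :=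
  if n is m.+1 then
    word_ball m ++ [seq (s * g)%g | s <- [:: grig_a; grig_b; grig_c; grig_d], g <- word_ball m]
  else [:: 1%g].
Arguments word_ball : simpl never.

Lemma word_ball_cat n : word_ball n.+1 =
  word_ball n ++ [seq (s * g)%g | s <- [:: grig_a; grig_b; grig_c; grig_d], g <- word_ball n].
Proof. by []. Qed.

Lemma word_ball_gen s g n : grig_gens s -> g \in word_ball n -> (s * g)%g \in word_ball n.+1.
Proof.
move=> /grig_gensP sS gn; rewrite word_ball_cat mem_cat; apply/orP; right.
by apply/allpairsP; exists (s, g); split=> //; case: sS => ->; rewrite !inE eqxx ?orbT.
Qed.

Lemma word_ballS g n : g \in word_ball n.+1 -> g \in word_ball n \/
  exists s h, [/\ grig_gens s, h \in word_ball n & g = (s * h)%g].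
Proof.
rewrite word_ball_cat mem_cat => /orP[|/allpairsP[[s h] /= [sS hn ->]]]; first by left.
right; exists s, h; split=> //; apply/grig_gensP.
by move: sS; rewrite !inE => /or4P[] /eqP->; do [exact: Or41|exact: Or42|exact: Or43|exact: Or44].
Qed.

Lemma word_ball_le m n : (m <= n)%N -> {subset word_ball m <= word_ball n}.
Proof.
move=> /subnKC <- g gm; elim: (n - m)%N => [|k IH]; first by rewrite addn0.
by rewrite addnS word_ball_cat mem_cat IH.
Qed.

Lemma word_ball1 n : 1%g \in word_ball n.
Proof. by apply: (@word_ball_le 0) => //; rewrite inE. Qed.

Lemma word_ball_mul m n g h : g \in word_ball m -> h \in word_ball n -> (g * h)%g \in word_ball (m + n).
Proof.
move=> + hn; elim: m g => [|m IH] g; first by rewrite mem_seq1 => /eqP ->; rewrite mul1g.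
move=> /word_ballS[/IH|[s [g' [sS /IH gm ->]]]]; first by apply: word_ball_le; rewrite addSn.
by rewrite addSn -mulgA; exact: word_ball_gen.
Qed.

Lemma word_ball_gen1 s : grig_gens s -> s \in word_ball 1.
Proof. by move=> sS; rewrite -[s]mulg1; apply: word_ball_gen => //; exact: word_ball1. Qed.

Lemma word_ball_inv n g : g \in word_ball n -> (g^-1)%g \in word_ball n.
Proof.
elim: n g => [|n IH] g; first by rewrite !mem_seq1 => /eqP ->; rewrite invg1.
move=> /word_ballS[/IH|[s [h [sS /IH hn ->]]]]; first exact: word_ball_le.
by rewrite invgM (grig_gens_sym sS) -addn1; apply: word_ball_mul => //; exact: word_ball_gen1.
Qed.

Lemma word_ball_all g : exists n, g \in word_ball n.
Proof.
move: g; suff : forall g, [set g | exists n, g \in word_ball n] g by [].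
apply: grig_ind; first split.
- by exists 0%N; exact: word_ball1.
- by move=> g h [m gm] [n hn]; exists (m + n)%N; exact: word_ball_mul.
- by move=> g [m gm]; exists m; exact: word_ball_inv.
- by move=> s sS; exists 1%N; exact: word_ball_gen1.
Qed.

Definition ball_vertex L (Gam : mgraph L) n (v : vertex Gam)
    (d : dist_le mroot v n) : vertex (ball_graph Gam n) :=
  exist (fun v => dist_le mroot v n) v d.

Section Balls.
Variables (M : Type) (A : action grigorchuk M) (x : M).
Local Notation Gam := (marked_schreier_graph A x).
Local Notation OA := (orbit_action A x).

Lemma upath_word_ball m (u v : vertex Gam) : upath m u v -> exists2 g, g \in word_ball m & v = OA g u.
Proof.
elim: m u => [|m IH] u /=; first by move=> ->; exists 1%g; [exact: (word_ball1 0)|rewrite act1].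
move=> [u' [[w [s sS]] /= e] /IH[g gm ->]]; exists (g * s)%g.
  by rewrite -addn1; apply: word_ball_mul => //; exact: word_ball_gen1.
rewrite actM; congr (OA g _); case: e => -[]; first by move=> -> ->.
by move=> -> <-; have := actK OA s u'; rewrite (grig_gens_sym sS) => ->.
Qed.

Lemma dist_leP (v : vertex Gam) n :
  dist_le mroot v n <-> exists2 g, g \in word_ball n & sval v = A g x.
Proof.
split=> [[m mn /upath_word_ball[g gm ->]]|[g gn vg]].
  by exists g => //; exact: word_ball_le gm.
elim: n g v gn vg => [|n IH] g v.
  rewrite mem_seq1 => /eqP -> vx; exists 0%N => //=; apply: eq_sval; rewrite vx act1.
  by [].
move=> /word_ballS[gn vg|[s [h [sS hn ->]]]].
  by have [m mn p] := IH _ _ gn vg; exists m => //; exact: leqW.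
rewrite actM => vs.
have [m mn p] := IH h (OA h (orbit_base A x)) hn erefl.
exists (m + 1)%N; first by rewrite addn1.
apply: upath_cat p _; exists v => //.
exists (OA h (orbit_base A x), exist _ s sS); left; split=> //=.
by apply: eq_sval; rewrite vs.
Qed.
End Balls.

Section BallIso.
Variables (M : Type) (A : action grigorchuk M) (x : M).
Variables (N : Type) (C : action grigorchuk N) (y : N).
Local Notation Gam1 := (marked_schreier_graph A x).
Local Notation Gam2 := (marked_schreier_graph C y).

(** A word of length at most [n] traces from the root a path inside the ball of radius [n]. An
    isomorphism preserving labels and roots carries it to the path of the same word, so closed paths
    correspond. *)
Lemma ball_iso_stab n : mgraph_iso (ball_graph Gam1 n) (ball_graph Gam2 n) ->
  forall g, g \in word_ball n -> A g x = x <-> C g y = y.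
Proof.
move=> [f [k [[f' fK f'K] _ froot fk]]].
have key m : (m <= n)%N -> forall g, g \in word_ball m -> forall v : vertex (ball_graph Gam1 n),
    sval (sval v) = A g x -> sval (sval (f v)) = C g y.
  elim: m => [|m IH] mn g.
    rewrite mem_seq1 => /eqP -> v; rewrite !act1 => vx.
    have -> : v = mroot by do 2!apply: eq_sval.
    by rewrite froot.
  move=> /word_ballS[|[s [h [sS hm ->]]]]; first by apply: IH; exact: ltnW.
  move=> v; rewrite actM => vs.
  have dh : @dist_le _ (marked_schreier_graph A x) mroot (orbit_action A x h (orbit_base A x)) n.
    by apply/dist_leP; exists h => //; apply: word_ball_le hm; exact: ltnW.
  pose u : vertex (ball_graph Gam1 n) := ball_vertex dh.
  have dt : @dist_le _ (marked_schreier_graph A x) mroot (orbit_action A x s (sval u)) n.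
    have -> : orbit_action A x s (sval u) = sval v by apply: eq_sval; rewrite vs.
    exact: (svalP v).
  pose e : edge (ball_graph Gam1 n) := exist _ (sval u, exist _ s sS) (conj dh dt).
  have [es et el] := fk e.
  have <- : tgt e = v by do 2!apply: eq_sval; rewrite /= vs.
  have eu : src e = u by exact: eq_sval.
  rewrite -et actM -(IH (ltnW mn) h hm u erefl) -eu -es.
  by move: el; rewrite /=; case: (k e) => -[w [t tS]] /= _ ->.
have root_inj (v : vertex (ball_graph Gam2 n)) : sval (sval v) = y -> v = mroot.
  by move=> vy; do 2!apply: eq_sval.
move=> g gn; have dg : @dist_le _ (marked_schreier_graph A x) mroot (orbit_action A x g (orbit_base A x)) n.
  by apply/dist_leP; exists g.
pose v : vertex (ball_graph Gam1 n) := ball_vertex dg.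
have vg := key n (leqnn n) g gn v erefl.
split=> [gx|gy].
- have vr : v = mroot by do 2!apply: eq_sval.
  by rewrite -vg vr froot.
- rewrite -vg in gy; move/root_inj: gy; rewrite -froot => /(can_inj fK).
  by move/(congr1 (fun u => sval (sval u))).
Qed.

(** Vertices are named by words. A name [g] of length at most [n.+1] is compared with a chosen name
    [h] of length at most [n] through [h^-1 * g], whence the radius [(n + n).+1]. *)
Lemma ball_transport n :
  (forall g, g \in word_ball (n + n).+1 -> A g x = x <-> C g y = y) ->
  exists f : vertex (ball_graph Gam1 n) -> vertex (ball_graph Gam2 n),
    forall v g, g \in word_ball n.+1 -> sval (sval v) = A g x -> sval (sval (f v)) = C g y.
Proof.
move=> xy; have shift (K : Type) (D : action grigorchuk K) z g h :
    D g z = D h z <-> D (h^-1 * g)%g z = z.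
  by rewrite actM; split=> [->|e]; [rewrite actK|rewrite -[in RHS]e actVK].
have wit (v : vertex (ball_graph Gam1 n)) : exists u : vertex (ball_graph Gam2 n),
    forall g, g \in word_ball n.+1 -> sval (sval v) = A g x -> sval (sval u) = C g y.
  have /dist_leP [h hn vh] := svalP v.
  have dh : @dist_le _ (marked_schreier_graph C y) mroot (orbit_action C y h (orbit_base C y)) n.
    by apply/dist_leP; exists h.
  exists (ball_vertex dh) => g gn; rewrite vh => /shift e; apply/shift/xy => //.
  rewrite -addSn; apply: word_ball_mul => //; exact: word_ball_inv.
by exists (fun v => sval (cid (wit v))) => v g; case: cid => u /=; exact.
Qed.
End BallIso.

Lemma stab_ball_iso (M : Type) (A : action grigorchuk M) (x : M)
    (N : Type) (C : action grigorchuk N) (y : N) n :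
  (forall g, g \in word_ball (n + n).+1 -> A g x = x <-> C g y = y) ->
  mgraph_iso (ball_graph (marked_schreier_graph A x) n)
             (ball_graph (marked_schreier_graph C y) n).
Proof.
move=> xy; have yx g : g \in word_ball (n + n).+1 -> C g y = y <-> A g x = x.
  by move=> /xy[? ?]; split.
have [f fE] := ball_transport xy; have [f' f'E] := ball_transport yx.
have fK : cancel f f'.
  move=> v; have /dist_leP [g /(word_ball_le (leqnSn n)) gn vg] := svalP v.
  do 2!apply: eq_sval; rewrite (f'E _ g) //.
  exact: fE.
have f'K : cancel f' f.
  move=> v; have /dist_leP [g /(word_ball_le (leqnSn n)) gn vg] := svalP v.
  do 2!apply: eq_sval; rewrite (fE _ g) //.
  exact: f'E.
(* If [g] names the source of [e], then the label times [g] names its end; this name can have length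
   [n.+1], which is why [ball_transport] admits such names. *)
have stepf (e : edge (ball_graph (marked_schreier_graph A x) n)) :
    orbit_action C y (sval (sval e).2) (sval (f (src e))) = sval (f (tgt e)).
  have /dist_leP [g gn vg] := svalP (src e).
  have sS := svalP (sval e).2.
  apply: eq_sval; rewrite /= (fE _ g) //; last exact: word_ball_le gn.
  rewrite (fE (induced_tgt e) (sval (sval e).2 * g)%g) ?actM //; first exact: word_ball_gen.
  by rewrite /= -vg.
have stepf' (e : edge (ball_graph (marked_schreier_graph C y) n)) :
    orbit_action A x (sval (sval e).2) (sval (f' (src e))) = sval (f' (tgt e)).
  have /dist_leP [g gn vg] := svalP (src e).
  have sS := svalP (sval e).2.
  apply: eq_sval; rewrite /= (f'E _ g) //; last exact: word_ball_le gn.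
  rewrite (f'E (induced_tgt e) (sval (sval e).2 * g)%g) ?actM //; first exact: word_ball_gen.
  by rewrite /= -vg.
pose kE e : dist_le mroot (sval (f (src e))) n /\
    @dist_le _ (marked_schreier_graph C y) mroot (orbit_action C y (sval (sval e).2) (sval (f (src e)))) n :=
  conj (svalP (f (src e))) (eq_ind_r (fun v => dist_le mroot v n)
    (svalP (f (tgt e))) (stepf e)).
pose k'E e : dist_le mroot (sval (f' (src e))) n /\
    @dist_le _ (marked_schreier_graph A x) mroot (orbit_action A x (sval (sval e).2) (sval (f' (src e)))) n :=
  conj (svalP (f' (src e))) (eq_ind_r (fun v => dist_le mroot v n)
    (svalP (f' (tgt e))) (stepf' e)).
pose k (e : edge (ball_graph (marked_schreier_graph A x) n)) :
    edge (ball_graph (marked_schreier_graph C y) n) :=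
  exist _ (sval (f (src e)), (sval e).2) (kE e).
pose k' (e : edge (ball_graph (marked_schreier_graph C y) n)) :
    edge (ball_graph (marked_schreier_graph A x) n) :=
  exist _ (sval (f' (src e)), (sval e).2) (k'E e).
have srck e : src (k e) = f (src e) by exact: eq_sval.
have srck' e : src (k' e) = f' (src e) by exact: eq_sval.
have kval e : sval (k e) = (sval (f (src e)), (sval e).2) by [].
have k'val e : sval (k' e) = (sval (f' (src e)), (sval e).2) by [].
exists f, k; split.
- by exists f'.
- exists k' => e; apply: eq_sval.
    by rewrite k'val srck fK /=; case: (sval e).
  by rewrite kval srck' f'K /=; case: (sval e).
- have /= e1 := fE (@Defs.root _ (ball_graph (marked_schreier_graph A x) n)) 1%g (word_ball1 _); do 2!apply: eq_sval.
  by rewrite e1 ?act1.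
- move=> e; split=> //; apply: eq_sval; exact: stepf.
Qed.

(** Existential over the representatives of an isomorphism class; by [stabE] any one of them
    computes it. *)
Definition stab (C : Sch) : set grigorchuk := [set g |
  exists (M : Type) (A : action grigorchuk M) (x : M),
    C = marked_schreier A x /\ A g x = x].

Lemma stabE (M : Type) (A : action grigorchuk M) (x : M) g :
  stab (marked_schreier A x) g <-> A g x = x.
Proof.
split=> [[N [C [y [e gy]]]]|gx]; first exact/(marked_schreier_stab e).
by exists M, A, x.
Qed.

Lemma stab_inj C D : (forall g, stab C g <-> stab D g) -> C = D.
Proof.
have [M [A [x ->]]] := sch_repr C; have [N [E [y ->]]] := sch_repr D => h.
by apply/marked_schreier_eqP => g; have := h g; rewrite !stabE.
Qed.

Lemma stab1 C : stab C 1%g.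
Proof. by have [M [A [x ->]]] := sch_repr C; rewrite stabE act1. Qed.

Lemma stabM C g h : stab C g -> stab C h -> stab C (g * h)%g.
Proof.
by have [M [A [x ->]]] := sch_repr C; rewrite !stabE actM => + ->.
Qed.

Lemma stabV C g : stab C g -> stab C g^-1%g.
Proof.
by have [M [A [x ->]]] := sch_repr C; rewrite !stabE => {1}<-; rewrite actK.
Qed.

Lemma stab_act C g h : stab (sch_action g C) h <-> stab C (g^-1 * h * g)%g.
Proof.
have [M [A [x ->]]] := sch_repr C; rewrite [sch_action _ _]sch_actE !stabE !actM.
split=> [->|e]; first by rewrite actK.
by rewrite -[in RHS]e actVK.
Qed.

(** * Every subgroup is a stabilizer: the action on left cosets *)

Section CosetAction.
Variable H : set grigorchuk.
Hypothesis sgH : is_subgroup H.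

(* Not written with [set], to stay in the universe of small types. *)
Definition lcoset (g h : grigorchuk) : Prop := H (g^-1 * h)%g.

Definition lcosets : Type := {X : grigorchuk -> Prop | exists g, X = lcoset g}.

Lemma lcoset_eq g h : lcoset g = lcoset h <-> H (g^-1 * h)%g.
Proof.
have [H1 HM HV] := sgH; split=> [|gh].
  by move/(congr1 (fun X => X h)); rewrite /lcoset mulVg => ->.
apply/funext => k; apply/propext; rewrite /lcoset; split=> e.
  have -> : (h^-1 * k = (g^-1 * h)^-1 * (g^-1 * k))%g.
    by rewrite invgM invgK -!mulgA mulVKg.
  by apply: HM => //; exact: HV.
have -> : (g^-1 * k = (g^-1 * h) * (h^-1 * k))%g by rewrite -!mulgA mulVKg.
exact: HM.
Qed.

Lemma lcosets_act_proof g (X : lcosets) :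
  exists k, (fun h => sval X (g^-1 * h)%g) = lcoset k.
Proof.
case: X => X /= [k ->]; exists (g * k)%g; apply/funext => h.
by rewrite /lcoset invgM mulgA.
Qed.

Definition lcosets_act g (X : lcosets) : lcosets := exist _ _ (lcosets_act_proof g X).

Lemma lcosets_act1 X : lcosets_act 1%g X = X.
Proof. by apply: eq_sval; apply/funext => h; rewrite /= invg1 mul1g. Qed.

Lemma lcosets_actM g h X :
  lcosets_act (g * h)%g X = lcosets_act g (lcosets_act h X).
Proof. by apply: eq_sval; apply/funext => k; rewrite /= invgM mulgA. Qed.

Definition lcosets_action : action grigorchuk lcosets :=
  Action lcosets_act1 lcosets_actM.

(** This realizes the limit graphs at 1^oo, which are first known only through their stabilizers. *)
Lemma subgroup_stab : exists C, forall g, stab C g <-> H g.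
Proof.
have [H1 HM HV] := sgH.
pose X : lcosets := exist _ (lcoset 1%g) (ex_intro _ 1%g erefl).
exists (marked_schreier lcosets_action X) => g; rewrite stabE.
have -> : lcosets_action g X = X <-> lcoset 1%g = lcoset g.
  have e : sval (lcosets_action g X) = lcoset g.
    by apply/funext => h; rewrite /= /lcoset invg1 mul1g.
  by rewrite -e; split=> [->//|e']; apply: eq_sval; exact: esym e'.
by rewrite lcoset_eq invg1 mul1g.
Qed.
End CosetAction.

(** A finite window on the stabilizer, seen as a point of {0,1}^G. Windows are finite words, so the
    sets that they define form a countable base. *)
Definition stab_pattern (n : nat) (C : Sch) : seq bool := [seq `[< stab C g >] | g <- word_ball n].

Lemma stab_patternP n C D : stab_pattern n C = stab_pattern n D <-> forall g, g \in word_ball n -> stab C g <-> stab D g.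
Proof.
rewrite /stab_pattern -(@seq.eq_in_map grigorchuk); split=> h.
  by move=> g gn; exact: (asbool_eq_equiv (h g gn)).
by move=> g gn; exact: (asbool_equiv_eq (h g gn)).
Qed.

Lemma stab_pattern_le m n C D : (m <= n)%N -> stab_pattern n C = stab_pattern n D -> stab_pattern m C = stab_pattern m D.
Proof. by move=> mn /stab_patternP h; apply/stab_patternP => g /(word_ball_le mn)/h. Qed.

Lemma sch_nbhs_stab_pattern (C : Sch) (U : set Sch) :
  nbhs C U <-> exists n, [set D | stab_pattern n D = stab_pattern n C] `<=` U.
Proof.
have dE (D E : Sch) (m : nat) : forall (M : Type) (A : action grigorchuk M) (x : M)
   (N : Type) (A' : action grigorchuk N) (y : N),
   D = marked_schreier A x -> E = marked_schreier A' y ->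
   balls_differ (val D) (val E) m <->
   ~ mgraph_iso (ball_graph (marked_schreier_graph A x) m)
                (ball_graph (marked_schreier_graph A' y) m).
  by move=> M A x N A' y -> ->; exact: balls_differE.
rewrite sch_nbhsP; split=> [[e e0 eU]|[n nU]].
  have [N Ne] : exists N, (2%:R ^- N < e :> rat)%R.
    exists (Num.bound e^-1); rewrite -[ltRHS]invrK ltf_pV2 ?posrE ?invr_gt0 ?exprn_gt0//.
    have := @archi_boundP rat e^-1%R; rewrite invr_ge0 ltW// => /(_ isT) /lt_trans; apply.
    by rewrite -natrX ltr_nat ltn_expl.
  (* Equal patterns up to [(N + N).+1] make all balls of radius below [N] isomorphic, so a radius at
     which the balls differ is at least [N]. *)
  exists (N + N).+1 => D /stab_patternP DC; apply: eU; apply/delta_lt => // m.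
  have [M [A [x Cx]]] := sch_repr C; have [M' [A' [y Dy]]] := sch_repr D.
  rewrite (dE _ _ m _ _ _ _ _ _ Cx Dy) => nb; apply: le_lt_trans Ne.
  rewrite lef_pV2 ?posrE ?exprn_gt0// ler_weXn2l// ?ler1n//.
  rewrite leqNgt; apply/negP => mN; apply: nb; apply: stab_ball_iso => g gm.
  have /DC : g \in word_ball (N + N).+1 by apply: word_ball_le gm; rewrite ltnS; lia.
  by rewrite Cx Dy !stabE => -[? ?]; split.
(* A distance below [2 ^- n] excludes [n] from the radii at which the balls differ. *)
exists (2%:R ^- n)%R; first by rewrite invr_gt0 exprn_gt0.
move=> D /=; rewrite delta_lt ?invr_gt0 ?exprn_gt0// => /(_ n) h.
apply: nU => /=; apply/stab_patternP => g gn.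
have [M [A [x Cx]]] := sch_repr C; have [M' [A' [y Dy]]] := sch_repr D.
have i : mgraph_iso (ball_graph (marked_schreier_graph A x) n)
    (ball_graph (marked_schreier_graph A' y) n).
  by apply: contrapT => /(dE _ _ n _ _ _ _ _ _ Cx Dy) /h; rewrite ltxx.
by have [? ?] := ball_iso_stab i gn; rewrite Cx Dy !stabE; split.
Qed.

(** * Boundary points of limit graphs *)

Lemma boundary_nbhs (xi : boundary) (U : set boundary) :
  nbhs xi U <-> exists n, [set zeta | mkseq zeta n = mkseq xi n] `<=` U.
Proof.
split=> [|[n nU]].
  pose D n : set boundary := [set zeta | mkseq zeta n = mkseq xi n].
  pose F := filter_from [set: nat] D.
  have FF : Filter F.
    apply: filter_from_filter; first by exists 0%N.
    move=> i j _ _; exists (maxn i j) => // z zij.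
    by split; apply: mkseq_le zij; rewrite ?leq_maxl ?leq_maxr.
  (* Convergence in the product is tested on each coordinate, and coordinate [i] is constant on
     cylinders of level [i.+1]. *)
  have : F --> (xi : cantor_space).
    apply/cvg_sup => i; apply/cvg_image.
      rewrite eqEsubset; split => // y _; exists (fun=> y) => //.
    move=> V /= /principal_filterP Vx.
    exists (@^~ i @^-1` V); first exists i.+1 => // z /mkseq_eqP /(_ i (leqnn _)) /= zi.
      by rewrite /= zi.
    apply/seteqP; split=> [b [z Vz <-]//|b Vb].
    by exists (fun=> b).
  by move=> h /h[n _ nU]; exists n.
apply: filterS nU _; elim: n => [|n IH]; first by apply: filterS filterT.
have pn : nbhs xi (@proj nat (fun=> bool) n @^-1` [set xi n]).
  by apply: (@proj_continuous nat (fun=> bool) n xi); exact: discrete_set1.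
apply: filterS (filterI IH pn) => z [/= zn zin].
by rewrite !mkseqS zn; congr rcons.
Qed.

Lemma eventually_all (T : eqType) (P : T -> nat -> Prop) :
  (forall x, exists N, forall n, (N <= n)%N -> P x n) ->
  forall s : seq T, exists N, forall n, (N <= n)%N -> forall x, x \in s -> P x n.
Proof.
move=> h; elim=> [|x s [N hN]]; first by exists 0%N.
have [M hM] := h x; exists (maxn M N) => n; rewrite geq_max => /andP[Mn Nn] y.
by rewrite in_cons => /predU1P[->|ys]; [exact: hM|exact: hN].
Qed.

Lemma stab_pattern_inj C D : (forall n, stab_pattern n C = stab_pattern n D) -> C = D.
Proof.
by move=> h; apply: stab_inj => g; have [n gn] := word_ball_all g; move/stab_patternP: (h n); exact.
Qed.

Lemma sch_closureP (S : set Sch) C :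
  closure S C <-> forall n, exists2 D, S D & stab_pattern n D = stab_pattern n C.
Proof.
split=> [cSC n|h U /sch_nbhs_stab_pattern[n nU]].
  have [|D [SD DC]] := cSC [set D | stab_pattern n D = stab_pattern n C]; last by exists D.
  by apply/sch_nbhs_stab_pattern; exists n.
by have [D SD DC] := h n; exists D; split=> //; exact: nU.
Qed.

Lemma sch_act_stab_pattern g n : exists m, forall C D, stab_pattern m C = stab_pattern m D ->
  stab_pattern n (sch_action g C) = stab_pattern n (sch_action g D).
Proof.
have [k gk] := word_ball_all g; exists (k + n + k)%N => C D /stab_patternP h.
apply/stab_patternP => l ln; rewrite !stab_act; apply: h.
by apply: word_ball_mul => //; apply: word_ball_mul => //; exact: word_ball_inv.
Qed.

Local Notation F := boundary_schreier.

Lemma stab_F xi g : stab (F xi) g <-> B g xi = xi.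
Proof. exact: stabE. Qed.

Lemma F_act g xi : sch_action g (F xi) = F (B g xi).
Proof. exact: sch_actE. Qed.

Definition mover v : grigorchuk := sval (cid (cylinder_mover v)).

Lemma stab_mover xi v : stab (F xi) (mover v) <-> mkseq xi (size v) <> v.
Proof. by rewrite stab_F /mover; case: cid. Qed.

(* The point underlying a graph is read off letter by letter: a letter is [1]
   when the element moving exactly the cylinder of that prefix moves the root. *)
Fixpoint prefix_of (C : Sch) n : seq bool :=
  if n is m.+1 then
    rcons (prefix_of C m) (~~ `[< stab C (mover (rcons (prefix_of C m) true)) >])
  else [::].

Definition base_point (C : Sch) : boundary :=
  fun n => ~~ `[< stab C (mover (rcons (prefix_of C n) true)) >].

Lemma mkseq_base_point C n : mkseq (base_point C) n = prefix_of C n.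
Proof. by elim: n => // n IH; rewrite mkseqS IH. Qed.

Lemma prefix_of_F xi n : prefix_of (F xi) n = mkseq xi n.
Proof.
elim: n => // n IH; rewrite mkseqS /= IH; congr rcons.
have := stab_mover xi (rcons (mkseq xi n) true).
rewrite size_rcons size_mkseq mkseqS => e.
by case: asboolP => [/e h|h]; case: (xi n) e h => //= e h;
  first [by case: h|by case: h; apply/e => /rcons_inj[]].
Qed.

Lemma base_point_F xi : base_point (F xi) = xi.
Proof.
apply: contrapT => /boundary_neqP[n].
by rewrite mkseq_base_point prefix_of_F.
Qed.

Lemma prefix_of_stab_pattern C n : exists N, forall D, stab_pattern N D = stab_pattern N C ->
  prefix_of D n = prefix_of C n.
Proof.
elim: n => [|n [N IH]]; first by exists 0%N.
have [k tk] := word_ball_all (mover (rcons (prefix_of C n) true)).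
exists (maxn N k) => D DC /=.
rewrite (IH D); last by apply: stab_pattern_le DC; exact: leq_maxl.
congr (rcons _ (~~ _)); apply: asbool_equiv_eq.
by move/(stab_pattern_le (leq_maxr _ _))/stab_patternP: DC; exact.
Qed.

Lemma base_point_continuous : continuous base_point.
Proof.
move=> C U /boundary_nbhs[n nU]; have [N NC] := prefix_of_stab_pattern C n.
apply/sch_nbhs_stab_pattern; exists N => D /NC e; apply: nU => /=.
by rewrite !mkseq_base_point.
Qed.

Local Notation cl := (closure (range F)).

(** A prefix of the base point depends on finitely many stabilizer memberships, so pattern and
    prefix can be approximated by the same [F xi]. *)
Lemma cl_approx C n N : cl C -> exists xi,
  stab_pattern N (F xi) = stab_pattern N C /\ mkseq xi n = mkseq (base_point C) n.
Proof.
move=> /sch_closureP clC; have [M MC] := prefix_of_stab_pattern C n.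
have [_ [xi _ <-] e] := clC (maxn N M); exists xi; split.
  by apply: stab_pattern_le e; exact: leq_maxl.
rewrite -prefix_of_F mkseq_base_point; apply: MC.
by apply: stab_pattern_le e; exact: leq_maxr.
Qed.

(** The lower bound [N <= H]: [g] stabilizes every [F xi] with [xi] close to the base point, and
    membership passes to the limit. *)
Lemma stab_near_base_point C g n : cl C ->
  (forall zeta, mkseq zeta n = mkseq (base_point C) n -> B g zeta = zeta) -> stab C g.
Proof.
move=> clC gn; have [N gN] := word_ball_all g; have [xi [/stab_patternP e /gn gx]] := cl_approx n N clC.
by apply/(e g gN)/stab_F.
Qed.

(** The upper bound [H <= Stab xi]: the approximating [xi] are fixed by [g] and share ever longer
    prefixes with the base point. *)
Lemma stab_base_point C g : cl C -> stab C g -> B g (base_point C) = base_point C.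
Proof.
move=> clC Cg; apply: contrapT => /boundary_neqP[n]; apply.
have [N gN] := word_ball_all g; have [xi [/stab_patternP e xn]] := cl_approx n N clC.
move/(e g gN)/stab_F : Cg => gx.
by rewrite mkseq_act -xn -mkseq_act gx.
Qed.

Lemma cl_act g C : cl C -> cl (sch_action g C).
Proof.
move=> /sch_closureP clC; apply/sch_closureP => n.
have [m h] := sch_act_stab_pattern g n; have [_ [xi _ <-] e] := clC m.
exists (F (B g xi)); first by exists (B g xi).
by rewrite -F_act; exact: h.
Qed.

Lemma base_point_act g C : cl C -> base_point (sch_action g C) = B g (base_point C).
Proof.
move=> clC; apply: contrapT => /boundary_neqP[n]; apply.
have [N NC] := prefix_of_stab_pattern (sch_action g C) n.
have [m h] := sch_act_stab_pattern g N; have [xi [e xn]] := cl_approx n m clC.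
rewrite mkseq_base_point -(NC _ (h _ _ e)) F_act prefix_of_F !mkseq_act.
by rewrite xn.
Qed.

Lemma cl_generic C : cl C -> ~ ones_orbit (base_point C) -> C = F (base_point C).
Proof.
move=> clC nO; apply: stab_inj => g; rewrite stab_F; split=> [|gx].
  exact: stab_base_point.
have [n gn] := act_trivial_near nO gx; exact: stab_near_base_point gn.
Qed.

(** Over a generic [xi] both bounds are locally constant: an element fixing [xi] fixes a
    neighbourhood, and one moving [xi] already moves a prefix. Closeness of base points thus forces
    closeness of graphs, on the whole closure. *)
Lemma generic_continuity xi n : ~ ones_orbit xi -> exists m, forall C, cl C ->
  mkseq (base_point C) m = mkseq xi m -> stab_pattern n C = stab_pattern n (F xi).
Proof.
move=> nO.
pose P g m := forall C, cl C -> mkseq (base_point C) m = mkseq xi m ->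
  stab C g <-> stab (F xi) g.
have [g|m h] := @eventually_all grigorchuk P _ (word_ball n).
  have [gx|gx] := pselect (B g xi = xi).
    have [m gm] := act_trivial_near nO gx; exists m => k mk C clC /(mkseq_le mk) e.
    split=> _; first exact/stab_F.
    by apply: (stab_near_base_point (n := m) clC) => zeta; rewrite e; exact: gm.
  have [m gm] := boundary_neqP gx; exists m => k mk C clC /(mkseq_le mk) e.
  split=> [/(stab_base_point clC) gC|/stab_F//]; exfalso; apply: gm.
  by rewrite mkseq_act -e -mkseq_act gC.
by exists m => C clC e; apply/stab_patternP => g gn; exact: (h m (leqnn m)).
Qed.

Lemma cl_F xi : cl (F xi).
Proof. by apply: subset_closure; exists xi. Qed.

(** * The three limit graphs at 1^oo *)

Lemma zpoint_dichotomy g i : (i < 3)%N -> exists N,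
  (forall m, (N <= m)%N -> m = i %[mod 3] -> B g (zpoint m) = zpoint m) \/
  (forall m, (N <= m)%N -> m = i %[mod 3] -> B g (zpoint m) <> zpoint m).
Proof.
move=> i3; have [g1|/boundary_neqP[n gn]] := pselect (B g ones = ones); last first.
  exists n; right => m nm _ gz; apply: gn.
  by rewrite mkseq_act -!(mkseq_zpoint nm) -mkseq_act gz.
(* Near 1^oo [g] acts as an element of the nucleus, and by [klein_fix] whether that fixes [zpoint m]
   depends only on [m] modulo 3. *)
have [k [n [nk kn]]] := act_near_ones g1; exists n.
have {}kn m : (n <= m)%N -> B g (zpoint m) = B k (zpoint m).
  by move=> nm; apply: kn; exact: mkseq_zpoint.
have [k1|[j j3 kj]] := nucleus_klein nk; first by left=> m nm _; rewrite kn// k1 act1.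
have [->|/eqP ij] := pselect (i = j).
  by left=> m nm mj; rewrite kn// kj zpointE; apply/klein_fix.
right=> m nm mi; rewrite kn// kj zpointE => /(klein_fix _ _ j3); rewrite mi !modn_small//.
exact/eqP.
Qed.

(** The limit inferior of the stabilizers of 1^m 0^oo along a residue class; [zpoint_dichotomy]
    makes it a true pointwise limit. *)
Definition zpoint_limit_stab i : set grigorchuk := [set g | exists N,
  forall m, (N <= m)%N -> m = i %[mod 3] -> B g (zpoint m) = zpoint m].

Lemma zpoint_limit_subgroup i : is_subgroup (zpoint_limit_stab i).
Proof.
split.
- by exists 0%N => m _ _; rewrite act1.
- move=> g h [N gN] [M hM]; exists (maxn N M) => m; rewrite geq_max => /andP[Nm Mm] mi.
  by rewrite actM hM// gN.
- by move=> g [N gN]; exists N => m Nm mi; rewrite -[in LHS](gN m Nm mi) actK.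
Qed.

Definition zpoint_limit i : Sch := sval (cid (subgroup_stab (zpoint_limit_subgroup i))).

Lemma stab_zpoint_limit i g : stab (zpoint_limit i) g <-> zpoint_limit_stab i g.
Proof. by rewrite /zpoint_limit; case: cid. Qed.

Lemma zpoint_limit_approx i n : (i < 3)%N -> exists N, forall m, (N <= m)%N ->
  m = i %[mod 3] -> stab_pattern n (F (zpoint m)) = stab_pattern n (zpoint_limit i).
Proof.
move=> i3; pose P g N := forall m, (N <= m)%N -> m = i %[mod 3] ->
  stab (F (zpoint m)) g <-> stab (zpoint_limit i) g.
have [g|N h] := @eventually_all grigorchuk P _ (word_ball n); last first.
  by exists N => m Nm mi; apply/stab_patternP => g /(h N (leqnn N)); exact.
have [N [gN|gN]] := zpoint_dichotomy g i3; exists N => M NM m Mm mi;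
  rewrite stab_F stab_zpoint_limit.
  by split=> _; [exists N|apply: gN => //; exact: leq_trans Mm].
split=> [/gN[]|[K gK]] //; first exact: leq_trans Mm.
(* An index of the residue class beyond both thresholds. *)
exfalso; apply: (gN (i + 3 * (N + K))%N); first by lia.
  by lia.
by apply: gK; [lia|lia].
Qed.

Definition generic_graphs : set Sch := F @` (~` ones_orbit).

Lemma zpoint_limit_closure i : (i < 3)%N -> closure generic_graphs (zpoint_limit i).
Proof.
move=> i3; apply/sch_closureP => n; have [N h] := zpoint_limit_approx n i3.
exists (F (zpoint (i + 3 * N))).
  by exists (zpoint (i + 3 * N)) => //; exact: zpoint_not_orbit.
by apply: h; [lia|lia].
Qed.

Lemma generic_graphs_cl : closure generic_graphs `<=` cl.
Proof. by apply: closure_subset => _ [xi _ <-]; exists xi. Qed.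

Lemma base_point_zpoint_limit i : (i < 3)%N -> base_point (zpoint_limit i) = ones.
Proof.
move=> i3; apply: contrapT => /boundary_neqP[n]; apply.
have [N hN] := prefix_of_stab_pattern (zpoint_limit i) n; have [M hM] := zpoint_limit_approx N i3.
rewrite mkseq_base_point -(hN (F (zpoint (i + 3 * (n + M))))).
  by rewrite prefix_of_F mkseq_zpoint//; lia.
by apply: hM; [lia|lia].
Qed.

Lemma stab_zpoint_limit_klein i j : (i < 3)%N -> (j < 3)%N ->
  stab (zpoint_limit i) (klein j) <-> i = j.
Proof.
move=> i3 j3; rewrite stab_zpoint_limit; split=> [[N h]|<-].
  have iN : (i + 3 * N = i %[mod 3])%N by lia.
  have : B (klein j) (zpoint (i + 3 * N)) = zpoint (i + 3 * N) by apply: h => //; lia.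
  by rewrite zpointE klein_fix// iN !modn_small.
by exists 0%N => m _ mi; rewrite zpointE; apply/klein_fix.
Qed.

Lemma klein_word_ball : exists N, forall j, klein j \in word_ball N.
Proof.
exists 1%N => j; case: j => [|[|[|j]]]; do ?[by rewrite /klein nth_default// word_ball1];
  apply: word_ball_gen1; apply/grig_gensP; do [exact: Or44|exact: Or43|exact: Or42].
Qed.

(** Over 1^oo every stabilizing element is, modulo the neighbourhood stabilizer, in the Klein group,
    and all graphs of the closure over 1^oo contain that neighbourhood stabilizer. Hence their
    intersection with the Klein group determines them. *)
Lemma cl_ones_eq C D : cl C -> cl D -> base_point C = ones -> base_point D = ones ->
  (forall j, (j < 3)%N -> stab C (klein j) <-> stab D (klein j)) -> C = D.
Proof.
suff sub C' D' : cl C' -> cl D' -> base_point C' = ones -> base_point D' = ones ->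
    (forall j, (j < 3)%N -> stab C' (klein j) -> stab D' (klein j)) ->
    forall g, stab C' g -> stab D' g.
  move=> clC clD C1 D1 h; apply: stab_inj => g; split; apply: sub => // j j3;
  by have [] := h j j3.
move=> clC clD C1 D1 h g Cg.
have := stab_base_point clC Cg; rewrite C1 => /act_near_ones[k [n [nk kn]]].
(* [g] and [k] have the same germ at 1^oo, so [k^-1 * g] acts trivially near it. *)
have near E : cl E -> base_point E = ones -> stab E (k^-1 * g)%g.
  move=> clE E1; apply: (stab_near_base_point (n := n)) => // z; rewrite E1 => /kn e.
  by rewrite actM e actK.
have Dk : stab D' k.
  have [->|[j j3 kj]] := nucleus_klein nk; first exact: stab1.
  rewrite kj; apply: h => //; rewrite -kj.
  have -> : (k = g * (k^-1 * g)^-1)%g by rewrite invgM invgK mulVKg.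
  by apply: stabM => //; apply: stabV; exact: near.
by rewrite -(mulVKg k g); apply: stabM => //; exact: near.
Qed.

(** The memberships of [b], [c], [d] are read off an approximating [F xi]: all three hold when [xi]
    is 1^oo, and otherwise only the one selected by the number of leading ones modulo 3. *)
Lemma cl_ones C : cl C -> base_point C = ones ->
  C = F ones \/ exists2 i, (i < 3)%N & C = zpoint_limit i.
Proof.
move=> clC C1; have [N klN] := klein_word_ball; have [xi [/stab_patternP e _]] := cl_approx 0 N clC.
have {}e j : stab C (klein j) <-> B (klein j) xi = xi.
  by have [? ?] := e _ (klN j); rewrite -stab_F; split.
have [x1|[m [z xz]]] := onesVzero xi; [left|right].
  apply: cl_ones_eq => //; [exact: cl_F|by rewrite base_point_F|move=> j _].
  by rewrite e x1 stab_F.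
have m3 : (m %% 3 < 3)%N by rewrite ltn_mod.
exists (m %% 3)%N => //; apply: cl_ones_eq => //.
- exact/generic_graphs_cl/zpoint_limit_closure.
- exact: base_point_zpoint_limit.
- move=> j j3; rewrite stab_zpoint_limit_klein// e xz klein_fix//.
  by rewrite (modn_small j3).
Qed.

(** * Isolated points of the closure, and minimality *)

Lemma F_ones_orbit_isolated xi : ones_orbit xi -> isolated cl (F xi).
Proof.
move=> [g <-]; split; first exact/mem_set/cl_F.
have [N klN] := klein_word_ball; have [m h] := sch_act_stab_pattern g^-1%g N.
exists [set D | stab_pattern m D = stab_pattern m (F (B g ones))]; first by apply/sch_nbhs_stab_pattern; exists m.
apply/seteqP; split=> [D [/= Dm clD]|_ ->]; last by split=> //; exact: cl_F.
suff -> : D = sch_action g (F ones) by rewrite F_act.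
apply: (can_inj (actK sch_action g^-1%g)); rewrite actK.
(* Translation back by [g] reduces to a graph [E] near [F ones], so that [b], [c] and [d] all
   stabilize it and each approximating [F zeta]. *)
have := h _ _ Dm; rewrite -F_act actK; have := @cl_act g^-1%g _ clD.
move: (sch_action _ D) => E clE EN; apply: stab_pattern_inj => n.
have [zeta [e _]] := cl_approx 0 (maxn n N) clE.
have <- : zeta = ones; last by rewrite (stab_pattern_le _ e)// leq_maxl.
have {}e j : B (klein j) zeta = zeta.
  apply/stab_F; move/(stab_pattern_le (leq_maxr n N))/stab_patternP: e => /(_ _ (klN j)) [_]; apply.
  move/stab_patternP: EN => /(_ _ (klN j)) [_]; apply; apply/stab_F/nucleus_ones/klein_nucleus.
have [//|[k [z xz]]] := onesVzero zeta.
(* With a letter 0 in [zeta], the number of ones before it would be congruent to both 0 and 1 modulo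
   3. *)
have := e 0%N; have := e 1%N; rewrite xz !klein_fix// => -> //.
Qed.

Lemma generic_not_isolated xi : ~ ones_orbit xi -> ~ isolated cl (F xi).
Proof.
move=> nO [_ [V /sch_nbhs_stab_pattern[n nV] VF]].
have [m h] := generic_continuity n nO.
(* Changing one letter beyond the relevant prefix gives a different point whose graph has the same
   pattern. *)
pose zeta : boundary := fun i => if i == m then ~~ xi i else xi i.
have /= e : mkseq zeta m = mkseq xi m.
  by apply/mkseq_eqP => i im; rewrite /zeta ltn_eqF.
have : (V `&` cl) (F zeta).
  by split; [apply: nV; apply: h|]; rewrite ?base_point_F//; exact: cl_F.
rewrite VF => /(congr1 base_point); rewrite !base_point_F => /(congr1 (fun f => f m)).
by rewrite /zeta eqxx; case: (xi m).
Qed.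

(** By density of the range, an isolated point of the closure is some [F xi]; it is isolated exactly
    when [xi] lies in the orbit of 1^oo. *)
Lemma OmegaP C : Omega C <-> cl C /\ forall xi, ones_orbit xi -> C <> F xi.
Proof.
split=> [[clC niC]|[clC nC]]; first by split=> // xi /F_ones_orbit_isolated + CF; rewrite -CF.
split=> // iC; have [[xi xF]|nF] := pselect (exists xi, C = F xi).
  have [Ox|nO] := pselect (ones_orbit xi); first exact: (nC xi).
  by apply: (generic_not_isolated nO); rewrite -xF.
have [_ [V nV VC]] := iC; have [_ [[xi _ <-] Vx]] := clC V nV.
have : (V `&` cl) (F xi) by split=> //; exact: cl_F.
by rewrite VC => /esym Cxi; apply: nF; exists xi.
Qed.

Lemma Omega_cl : Omega `<=` cl.
Proof. by move=> C []. Qed.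

Lemma Omega_act g C : Omega C -> Omega (sch_action g C).
Proof.
move=> /OmegaP[clC nC]; apply/OmegaP; split; first exact: cl_act.
move=> xi Ox /(congr1 (sch_action g^-1%g)); rewrite actK F_act; apply: nC.
exact: (iffLR (@ones_orbit_act g^-1%g xi) Ox).
Qed.

Lemma Omega_generic xi : ~ ones_orbit xi -> Omega (F xi).
Proof.
move=> nO; apply/OmegaP; split; first exact: cl_F.
by move=> z Oz /(congr1 base_point); rewrite !base_point_F => e; apply: nO; rewrite e.
Qed.

Lemma Omega_fiber_generic xi : ~ ones_orbit xi ->
  Omega `&` base_point @^-1` [set xi] = [set F xi].
Proof.
move=> nO; apply/seteqP; split=> [C [/Omega_cl clC /= Cxi]|_ ->] /=.
  by move: nO; rewrite -Cxi; exact: cl_generic.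
by split; [exact: Omega_generic|rewrite base_point_F].
Qed.


Lemma closure_act (S : set Sch) : invariant_set sch_action S ->
  invariant_set sch_action (closure S).
Proof.
move=> iS g C /sch_closureP clC; apply/sch_closureP => n.
have [m h] := sch_act_stab_pattern g n; have [D SD e] := clC m.
by exists (sch_action g D); [exact: iS|exact: h].
Qed.

Lemma generic_graphs_act : invariant_set sch_action generic_graphs.
Proof.
move=> g _ [xi nO <-]; rewrite F_act; exists (B g xi) => // O.
exact/nO/(iffRL (@ones_orbit_act g xi)).
Qed.

Lemma Omega_base_ones C : Omega C -> base_point C = ones ->
  exists2 i, (i < 3)%N & C = zpoint_limit i.
Proof.
move=> /OmegaP[clC nC] /(cl_ones clC)[C1|//].
by case: (nC ones) => //; exact: act_orbit_refl.
Qed.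

Lemma Omega_zpoint_limit i : (i < 3)%N -> Omega (zpoint_limit i).
Proof.
move=> i3; apply/OmegaP; split; first exact/generic_graphs_cl/zpoint_limit_closure.
move=> xi _ e; have := base_point_zpoint_limit i3; rewrite e base_point_F => x1.
have kF j : stab (zpoint_limit i) (klein j).
  by rewrite e x1; apply/stab_F/nucleus_ones/klein_nucleus.
have := kF 0%N; have := kF 1%N; rewrite !stab_zpoint_limit_klein// => -> //.
Qed.

(** A graph over the orbit of 1^oo is a translate of some [zpoint_limit i], which is a limit of
    generic graphs, and these form an invariant set. *)
Lemma Omega_generic_closure : Omega `<=` closure generic_graphs.
Proof.
move=> C OC; have clC := Omega_cl OC.
have [[g gC]|nO] := pselect (ones_orbit (base_point C)); last first.
  by rewrite (cl_generic clC nO); apply: subset_closure; exists (base_point C).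
have [||i i3 Ci] := @Omega_base_ones (sch_action g^-1%g C).
- exact: Omega_act.
- by rewrite base_point_act// -gC actK.
rewrite -(actVK sch_action g C) Ci.
exact: (closure_act generic_graphs_act (zpoint_limit_closure i3)).
Qed.

(** Level transitivity moves the base point of [C] into any cylinder around a generic [xi];
    [generic_continuity] turns this into closeness to [F xi], and the generic graphs are dense in
    [Omega]. *)
Lemma Omega_orbit_dense C : Omega C -> Omega `<=` closure (act_orbit sch_action C).
Proof.
move=> OC; have clC := Omega_cl OC.
have gen : generic_graphs `<=` closure (act_orbit sch_action C).
  move=> _ [xi nO <-]; apply/sch_closureP => n.
  have [m h] := generic_continuity n nO.
  have [|g gC] := @level_transitive (mkseq (base_point C) m) (mkseq xi m).
    by rewrite !size_mkseq.
  exists (sch_action g C); first by exists g.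
  apply: h; first exact: cl_act.
  rewrite base_point_act//; have := (gC (base_point C)).1.
  by rewrite /cylinder/= !size_mkseq; exact.
move=> D /Omega_generic_closure/(closure_subset gen).
by rewrite -(closure_id _).1//; exact: closed_closure.
Qed.

Lemma Omega_closed : closed Omega.
Proof.
move=> C clOC; have clC : cl C.
  have := closure_subset Omega_cl clOC.
  by rewrite -(closure_id _).1//; exact: closed_closure.
(* A neighbourhood isolating [C] would contain a point of [Omega], which could only be [C]
   itself. *)
split=> // -[iC [V nV VC]]; have [D [OD VD]] := clOC V nV.
have : (V `&` cl) D by split=> //; exact: Omega_cl.
by rewrite VC => DC; case: OD => _; apply; rewrite DC; split=> //; exists V.
Qed.

Lemma Omega_minimal : minimal_invariant_set sch_action Omega.
Proof.
split; [|exact: Omega_closed|move=> g C; exact: Omega_act|exact: Omega_orbit_dense].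
by exists (zpoint_limit 0); exact: Omega_zpoint_limit.
Qed.

Lemma card_Omega_fiber_generic xi : ~ ones_orbit xi ->
  (Omega `&` base_point @^-1` [set xi] #= `I_1)%card.
Proof.
by move=> nO; rewrite Omega_fiber_generic//; exact: card_set1.
Qed.

Lemma card_Omega_fiber_ones_orbit xi : ones_orbit xi ->
  (Omega `&` base_point @^-1` [set xi] #= `I_3)%card.
Proof.
move=> [g gxi]; apply: card_esym; apply/card_set_bijP.
(* The fibre over 1^oo is carried along by [g]; [klein i] tells the three limits apart. *)
exists (fun i => sch_action g (zpoint_limit i)); split.
- move=> i i3; split; first exact/Omega_act/Omega_zpoint_limit.
  rewrite /= base_point_act; last exact/Omega_cl/Omega_zpoint_limit.
  by rewrite base_point_zpoint_limit.
- move=> i j /set_mem/= i3 /set_mem/= j3 /(can_inj (actK sch_action g)) e.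
  have : stab (zpoint_limit i) (klein i) by apply/stab_zpoint_limit_klein.
  by rewrite e stab_zpoint_limit_klein// => ->.
- move=> C [OC /= Cxi].
  have [||i i3 Ci] := @Omega_base_ones (sch_action g^-1%g C).
  + exact: Omega_act.
  + by rewrite base_point_act ?Cxi -?gxi ?actK//; exact: Omega_cl.
  + by exists i => //; rewrite -Ci actVK.
Qed.

Lemma countable_grigorchuk : countable [set: grigorchuk].
Proof.
apply: (@sub_countable _ _ _ (\bigcup_n [set` word_ball n])); last first.
  by apply: bigcup_countable => // n _; exact/finite_set_countable.
by apply: subset_card_le => g _; have [n gn] := word_ball_all g; exists n.
Qed.

Lemma countable_ones_orbit : countable ones_orbit.
Proof.
apply: (sub_countable _ (countable_grigorchuk)).
apply: (@card_le_trans _ _ _ ((fun g => B g ones) @` [set: grigorchuk])).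
  by apply: subset_card_le => _ [g <-]; exists g.
exact: card_image_le.
Qed.

Lemma Omega_extension : exists f : Sch -> boundary,
  [/\ {within Omega, continuous f}, f @` Omega = [set: boundary],
      (forall g C, Omega C -> f (sch_action g C) = B g (f C)) &
      exists E : set boundary, [/\ countable E, E !=set0,
        (forall xi, E xi -> (Omega `&` f @^-1` [set xi] #= `I_3)%card) &
        (forall xi, ~ E xi -> (Omega `&` f @^-1` [set xi] #= `I_1)%card)]].
Proof.
exists base_point; split.
- exact/continuous_subspaceT/base_point_continuous.
- apply/seteqP; split=> // xi _.
  have [[g gxi]|nO] := pselect (ones_orbit xi).
    exists (sch_action g (zpoint_limit 0)); first exact/Omega_act/Omega_zpoint_limit.
    rewrite base_point_act; last exact/Omega_cl/Omega_zpoint_limit.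
    by rewrite base_point_zpoint_limit.
  by exists (F xi); [exact: Omega_generic|rewrite base_point_F].
- by move=> g C OC; apply: base_point_act; exact: Omega_cl.
- exists ones_orbit; split.
  + exact: countable_ones_orbit.
  + by exists ones; exact: act_orbit_refl.
  + exact: card_Omega_fiber_ones_orbit.
  + exact: card_Omega_fiber_generic.
Qed.

(** * The uniform measure *)

Lemma open_measurable_borel (T : ptopologicalType) (U : set (borel T)) :
  @open T U -> measurable U.
Proof. by move=> oU; exact: sub_sigma_algebra. Qed.

Lemma closed_measurable_borel (T : ptopologicalType) (U : set (borel T)) :
  @closed T U -> measurable U.
Proof.
move=> cU; rewrite -(setCK U); apply: measurableC; apply: open_measurable_borel.
exact: closed_openC.
Qed.

(** * Borel measurability through a countable base *)

Section CountableBase.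
Variables (T : ptopologicalType) (I : countType) (b : I -> set T).
Hypothesis b_base : forall x U, nbhs x U -> exists2 i, b i x & b i `<=` U.

Lemma measurable_fun_base d (S : measurableType d) (h : S -> borel T) :
  (forall i, measurable (h @^-1` b i)) -> measurable_fun setT h.
Proof.
move=> mb; have mE : @measurable _ (borel T) = <<s @open T >> by [].
apply: (@measurability _ _ S (borel T) setT h _ mE) => _ [U oU <-].
have -> : setT `&` h @^-1` U =
    \bigcup_i (if pselect (b i `<=` U) then h @^-1` b i else set0).
  apply/seteqP; split=> [x [_ Ux]|x [i _]].
    have [i bx iU] := b_base (open_nbhs_nbhs (conj oU Ux)).
    by exists i => //; case: pselect.
  by case: pselect => //= iU bx; split=> //; exact: iU.
apply: countable_bigcupT_measurable => // i.
by case: pselect => iU /=; [exact: mb|exact: measurable0].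
Qed.

Lemma borel_base (X : set (borel T)) (G : set (set T)) :
  (forall i, <<s G >> (b i)) -> measurable X -> <<s G >> X.
Proof.
move=> bG mX.
(* Measurability of the identity from the sigma-algebra generated by [G] to the Borel one is the
   claimed inclusion. *)
have /(_ measurableT X mX) := @measurable_fun_base _ (g_sigma_algebraType G) id bG.
by rewrite setTI.
Qed.
End CountableBase.

Lemma boundary_base (xi : boundary) U : nbhs xi U ->
  exists2 w, cylinder w xi & cylinder w `<=` U.
Proof.
move=> /boundary_nbhs[n nU]; exists (mkseq xi n).
  by rewrite /cylinder/= size_mkseq.
by move=> z; rewrite /cylinder/= size_mkseq; exact: nU.
Qed.

Lemma open_cylinder w : @open boundary (cylinder w).
Proof.
rewrite openE => xi xw; apply/boundary_nbhs; exists (size w) => z /= zx.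
by rewrite /cylinder/= zx.
Qed.

Lemma measurable_cylinder w : measurable (cylinder w : set (borel boundary)).
Proof. exact: (@open_measurable_borel boundary _ (open_cylinder w)). Qed.

Definition pattern_set (np : nat * seq bool) : set Sch := [set C | stab_pattern np.1 C = np.2].

Lemma sch_base (C : Sch) U : nbhs C U ->
  exists2 np, pattern_set np C & pattern_set np `<=` U.
Proof. by move=> /sch_nbhs_stab_pattern[n nU]; exists (n, stab_pattern n C). Qed.

Lemma sch_act_continuous g : continuous (sch_action g).
Proof.
move=> C U /sch_nbhs_stab_pattern[n nU]; have [m h] := sch_act_stab_pattern g n.
by apply/sch_nbhs_stab_pattern; exists m => D /h e; exact: nU.
Qed.

(** [F] is discontinuous at the orbit of 1^oo. Still, the preimage of a pattern is a finite Boolean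
    combination of fixed-point sets of elements of the group, which are closed. *)
Lemma measurable_F : measurable_fun setT (F : borel boundary -> borel Sch).
Proof.
apply: (measurable_fun_base sch_base) => -[n p].
rewrite /pattern_set /stab_pattern /preimage /=.
elim: (word_ball n) p => [|g s IH] p /=.
  case: p => [|x p]; first by rewrite [X in measurable X](_ : _ = setT)//; apply/seteqP.
  by rewrite [X in measurable X](_ : _ = set0)//; apply/seteqP; split.
case: p => [|x p]; first by rewrite [X in measurable X](_ : _ = set0)//; apply/seteqP; split.
have mg : measurable ([set xi | B g xi = xi] : set (borel boundary)).
  apply: closed_measurable_borel; rewrite -openC openE => xi gx.
  have [N gN] := boundary_neqP gx; apply/boundary_nbhs; exists N => z /= zN gz.
  by apply: gN; rewrite mkseq_act -zN -mkseq_act gz.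
rewrite [X in measurable X](_ : _ = [set xi | `[< B g xi = xi >] = x] `&`
    [set xi | [seq `[< stab (F xi) h >] | h <- s] = p]); last first.
  apply/seteqP; split=> xi /=; rewrite (asbool_equiv_eq (stab_F xi g)).
    by case=> -> ->.
  by case=> -> ->.
apply: measurableI => //; case: x.
  rewrite [X in measurable X](_ : _ = [set xi | B g xi = xi])//.
  by apply/seteqP; split=> xi /= /asboolP.
rewrite [X in measurable X](_ : _ = ~` [set xi | B g xi = xi]); first exact: measurableC.
apply/seteqP; split=> xi /=; first by move=> /asboolPn.
by move=> nx; exact/asboolPn.
Qed.

Lemma measurable_base_point : measurable_fun setT (base_point : borel Sch -> borel boundary).
Proof.
apply: (measurable_fun_base boundary_base) => w; apply: open_measurable_borel.
by apply: (open_comp _ (open_cylinder w)) => C _; exact: base_point_continuous.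
Qed.

Lemma cylinderI v w : (size v <= size w)%N ->
  cylinder v `&` cylinder w = cylinder w \/ cylinder v `&` cylinder w = set0.
Proof.
move=> vw; have [e|/eqP ne] := eqVneq (take (size v) w) v; [left|right].
  apply/seteqP; split=> [xi []//|xi xw]; split=> //.
  rewrite /cylinder/= -[RHS]e -[in RHS]xw; move: vw; rewrite /mkseq -map_take => vw.
  by rewrite take_iota (minn_idPl vw).
apply/seteqP; split=> // xi [xv xw]; apply: ne.
by rewrite -[in LHS]xw /mkseq -map_take take_iota (minn_idPl vw).
Qed.

(** The empty set is included to make this a pi-system: two cylinders are nested or disjoint. *)
Definition cylinders : set (set boundary) := [set X | X = set0 \/ exists w, X = cylinder w].

Lemma cylinder_nil : cylinder [::] = setT.
Proof. by apply/seteqP. Qed.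

Lemma measurable_point (xi : boundary) : @measurable _ (borel boundary) [set xi].
Proof.
apply: (@closed_measurable_borel boundary); rewrite -openC openE => z /= zx.
have [n h] := boundary_neqP zx; apply/boundary_nbhs; exists n => z' /= z'n z'x.
by apply: h; rewrite -z'n z'x.
Qed.

Lemma measurable_ones_orbit : measurable (ones_orbit : set (borel boundary)).
Proof.
by apply: (@countable_measurable _ (borel boundary)) countable_ones_orbit; exact: measurable_point.
Qed.

Section Uniform.
Variable R : realType.
Local Open Scope ring_scope.
Local Open Scope ereal_scope.

Lemma boundary_measure_unique (m1 m2 : {measure set (borel boundary) -> \bar R}) :
  (forall w, m1 (cylinder w) = m2 (cylinder w)) -> m1 setT < +oo ->
  forall X, measurable X -> m1 X = m2 X.
Proof.
move=> m12 fin X mX.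
apply: (@measure_unique _ R (borel boundary) cylinders (fun=> cylinder [::])) => //.
- apply/seteqP; split=> Y mY.
    apply: (borel_base boundary_base _ mY) => w.
    by apply: sub_sigma_algebra; right; exists w.
  apply: (smallest_sub _ _ mY); first exact: sigma_algebra_measurable.
  by move=> _ [->|[w ->]]; [exact: measurable0|exact: measurable_cylinder].
- move=> _ _ [->|[v ->]] [->|[w ->]]; rewrite ?set0I ?setI0; try by left.
  have [/cylinderI[]->|/ltnW/cylinderI[]] := leqP (size v) (size w);
    by [right; exists w|left|rewrite setIC => ->; right; exists v|rewrite setIC => ->; left].
- by move=> _; right; exists [::].
- by rewrite cylinder_nil bigcup_const//; exists 0%N.
- by move=> _ [->|[w ->]//]; rewrite !measure0.
- by rewrite cylinder_nil.
Qed.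

Lemma cylinder_rcons w : cylinder w = cylinder (rcons w false) `|` cylinder (rcons w true).
Proof.
apply/seteqP; split=> xi; rewrite /cylinder/= !size_rcons !mkseqS.
  by move=> ->; case: (xi (size w)); [right|left].
by case=> /rcons_inj[].
Qed.

(** The two halves of a cylinder have equal measure, so each additional letter divides the measure
    by two. *)
Lemma level_invariant_uniform (m : probability (borel boundary) R) :
  (forall v w, size v = size w -> m (cylinder v) = m (cylinder w)) ->
  is_uniform_measure m.
Proof.
move=> mlevel; elim/last_ind => [|w x IH]; first by rewrite cylinder_nil probability_setT.
have e : m (cylinder (rcons w true)) = m (cylinder (rcons w false)).
  by apply: mlevel; rewrite !size_rcons.
have : m (cylinder (rcons w false)) + m (cylinder (rcons w false)) =
    (2^-1 ^+ size w)%:E.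
  rewrite -{2}e -IH (cylinder_rcons w) measureU//; do ?exact: measurable_cylinder.
  apply/seteqP; split=> // xi []; rewrite /cylinder/= !size_rcons => -> /rcons_inj[].
  by [].
have -> : m (cylinder (rcons w x)) = m (cylinder (rcons w false)) by case: x.
have : m (cylinder (rcons w false)) \is a fin_num.
  by apply: fin_num_measure; exact: measurable_cylinder.
case: (m _) => // r _; rewrite -EFinD => -[h]; congr EFin.
by rewrite size_rcons exprS -h; lra.
Qed.

(** The group permutes the cylinders of each level, so the image measure agrees with [m] on
    cylinders and hence everywhere. *)
Lemma uniform_measure_act (m : probability (borel boundary) R) g (X : set (borel boundary)) :
  is_uniform_measure m -> measurable X -> m (B g @^-1` X) = m X.
Proof.
move=> um mX.
have sz (v : seq bool) (h : grigorchuk) : size (val h v) = size v.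
  by rewrite -(mkseq_wcat v (fun=> false)) -mkseq_act !size_mkseq.
have cylE w : B g @^-1` cylinder w = cylinder (val g^-1%g w).
  apply/seteqP; split=> xi; rewrite /cylinder /preimage /mkset sz !mkseq_act gmulfV.
    by move=> e; rewrite -{2}e; exact: esym (ta_funK (val g) _).
  by move=> ->; exact: (ta_invK (val g)).
have mg : measurable_fun setT (B g : borel boundary -> borel boundary).
  apply: (measurable_fun_base boundary_base) => w; rewrite cylE.
  exact: measurable_cylinder.
pose mB := isMeasurableFun.Build _ _ _ _ _ mg.
pose h : {mfun borel boundary >-> borel boundary} := HB.pack (B g : borel boundary -> borel boundary) mB.
rewrite -[LHS]/(distribution m h X); apply: boundary_measure_unique => //.
  move=> w; transitivity (m (B g @^-1` cylinder w)) => //.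
  by rewrite cylE um sz; exact: esym (um w).
by rewrite [ltLHS](@probability_setT _ _ _ (distribution m h)) ltry.
Qed.

Lemma uniform_measure_point (m : probability (borel boundary) R) xi :
  is_uniform_measure m -> m [set xi] = 0.
Proof.
move=> um; have mx := measurable_point xi.
have le n : m [set xi] <= (2^-1 ^+ n)%:E.
  rewrite -[n](size_mkseq xi) -um; apply: le_measure; rewrite ?inE//.
    exact: measurable_cylinder.
  by move=> _ ->; rewrite /cylinder/= size_mkseq.
have : m [set xi] \is a fin_num by exact: fin_num_measure.
have : 0 <= m [set xi] by exact: measure_ge0.
case: (m _) le => // r le; rewrite lee_fin => r0 _; congr EFin.
apply/eqP; rewrite eq_le r0 andbT.
rewrite leNgt; apply/negP => rp.
(* For this [n] one has [1 / r < n < 2 ^ n], contradicting that the point lies in a cylinder of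
   measure [2 ^- n]. *)
have := le (Num.bound r^-1); rewrite lee_fin leNgt => /negP; apply.
rewrite exprVn -[ltRHS]invrK ltf_pV2 ?posrE ?invr_gt0 ?exprn_gt0//.
have := @archi_boundP R r^-1%R; rewrite invr_ge0 ltW// => /(_ isT) /lt_trans; apply.
by rewrite -natrX ltr_nat ltn_expl.
Qed.

Lemma uniform_measure_ones_orbit (m : probability (borel boundary) R) :
  is_uniform_measure m -> m ones_orbit = 0.
Proof.
move=> um; apply: measure_negligible.
  exact: measurable_ones_orbit.
(* The orbit is enumerated by radius and position in the word ball; past the end of the list the
   default 1 yields the point [ones], so each set is still a singleton. *)
have sub : ones_orbit `<=` \bigcup_n \bigcup_i [set B (nth 1%g (word_ball n) i) ones].
  move=> _ [g <-]; have [n gn] := word_ball_all g; exists n => //.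
  by exists (index g (word_ball n)) => //=; rewrite nth_index.
apply: (negligibleS (sub : subset (ones_orbit : set (borel boundary)) _)).
apply: negligible_bigcup => n; apply: negligible_bigcup => i.
apply/negligibleP; first exact: measurable_point.
exact: uniform_measure_point.
Qed.

Lemma measure_eq_ae d (T : measurableType d) (m : {measure set T -> \bar R})
    (Y X1 X2 : set T) : measurable Y -> m (~` Y) = 0 ->
  measurable X1 -> measurable X2 -> X1 `&` Y = X2 `&` Y -> m X1 = m X2.
Proof.
move=> mY Y0.
suff h X : measurable X -> m X = m (X `&` Y) by move=> /h -> /h -> ->.
move=> mX; rewrite -{1}(setIT X) -(setUv Y) setIUr measureU0//.
- exact: measurableI.
- by apply: measurableI => //; exact: measurableC.
- apply/eqP; rewrite -measure_le0 -Y0; apply: le_measure; rewrite ?inE//.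
  + by apply: measurableI => //; exact: measurableC.
  + exact: measurableC.
Qed.

End Uniform.

(** * Construction of the uniform measure as the law of binary digits under Lebesgue measure *)

Section BinaryDigits.
Variable R : realType.
Local Open Scope ring_scope.

Definition unit_measure : set (measurableTypeR R) -> \bar R :=
  mrestr lebesgue_measure (measurable_itv `[0%R, 1%R[).

HB.instance Definition _ := Measure.on unit_measure.

Let unit_measure_setT : unit_measure setT = 1%E.
Proof. by rewrite /unit_measure /mrestr setTI lebesgue_measure_itv/= lte_fin ltr01 sube0. Qed.

HB.instance Definition _ :=
  Measure_isProbability.Build _ _ _ unit_measure unit_measure_setT.

Definition doubling (x : R) : R := if (2^-1 <= x)%R then (2 * x - 1)%R else (2 * x)%R.

Definition binary_digits (x : R) : boundary := fun n => (2^-1 <= iter n doubling x)%R.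

Lemma binary_digitsE x : binary_digits x = bcons (2^-1 <= x)%R (binary_digits (doubling x)).
Proof. by apply/funext => -[|n] //; rewrite /binary_digits iterSr. Qed.

(** The left end of the dyadic interval of numbers in [0, 1) whose binary expansion starts with
    [w]. *)
Fixpoint cylinder_left (w : seq bool) : R :=
  if w is b :: w' then ((b%:R + cylinder_left w') / 2)%R else 0%R.

Lemma cylinder_left_ge0 w : (0 <= cylinder_left w)%R.
Proof. by elim: w => //= b w IH; rewrite divr_ge0// addr_ge0. Qed.

Lemma cylinder_left_le1 w : (cylinder_left w + 2^-1 ^+ size w <= 1)%R.
Proof.
elim: w => [|b w IH] /=; first by rewrite add0r.
by rewrite exprS; have : (b%:R <= 1 :> R)%R; [case: b|lra].
Qed.

Lemma binary_digits_cylinder w (x : R) : (0 <= x < 1)%R ->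
  cylinder w (binary_digits x) <->
  (cylinder_left w <= x < cylinder_left w + 2^-1 ^+ size w)%R.
Proof.
elim: w x => [|b w IH] x x01; first by rewrite /= add0r.
rewrite binary_digitsE {1}/cylinder/= mkseq_bcons exprS.
have c0 := cylinder_left_ge0 w; have c1 := cylinder_left_le1 w.
have /andP[x0 x1] := x01.
have d01 : (0 <= doubling x < 1)%R.
  by rewrite /doubling; case: (leP 2^-1%R x) => xh; apply/andP; split; lra.
have := IH _ d01; rewrite /cylinder/= => {}IH.
split=> [[bx /IH/andP[]]|/andP[h1 h2]].
  by move: bx; rewrite /doubling; case: (leP 2^-1%R x) => xh <- /= ? ?; apply/andP; split; lra.
have bx : (2^-1 <= x)%R = b.
  by case: b h1 h2 => /= h1 h2; [apply/idP|apply/negbTE; rewrite -ltNge]; lra.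
rewrite bx; congr cons; apply/IH; rewrite /doubling bx.
by case: b h1 h2 {bx} => /= h1 h2; apply/andP; split; lra.
Qed.

Lemma measurable_binary_digits :
  measurable_fun setT (binary_digits : measurableTypeR R -> borel boundary).
Proof.
apply: (measurable_fun_base boundary_base) => w.
elim: w => [|b w IH]; first by rewrite cylinder_nil preimage_setT.
have aff (k : R) : measurable ((fun x : measurableTypeR R => (2 * x - k)%R) @^-1`
    (binary_digits @^-1` cylinder w)).
  rewrite -[X in measurable X]setTI.
  have : measurable_fun setT (fun x : R => 2 * x - k)%R.
    by apply: measurable_funB => //; exact: measurable_funM.
  by move=> /(_ measurableT _ IH).
(* The first digit selects a half-line and a branch of the doubling map; writing the second branch
   as [2 * x - 0] lets [aff] cover both. *)
rewrite [X in measurable X](_ : _ = if b then (`[2^-1 : R, +oo[%classic : set R) `&`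
    ((fun x : R => 2 * x - 1)%R @^-1` (binary_digits @^-1` cylinder w))
  else (`]-oo, 2^-1 : R[%classic : set R) `&`
    ((fun x : R => 2 * x - 0)%R @^-1` (binary_digits @^-1` cylinder w))).
  by case: b; apply: measurableI.
have digE x : binary_digits x = bcons (2^-1 <= x) (binary_digits
    (2 * x - (if 2^-1 <= x then 1 else 0))).
  by rewrite binary_digitsE /doubling; case: ifP; rewrite ?subr0.
apply/seteqP; split=> x.
  rewrite /preimage/= digE /cylinder/= mkseq_bcons => -[xb e].
  by rewrite -xb; case: (leP 2^-1 x) e => xh e; split; rewrite //= in_itv/= ?xh.
case: b => -[/=]; rewrite in_itv/= ?andbT => xh e;
  rewrite /preimage/= digE /cylinder/= mkseq_bcons.
  by rewrite xh e.
by rewrite leNgt xh e.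
Qed.

Definition binary_digits_mfun : {mfun measurableTypeR R >-> borel boundary} :=
  HB.pack (binary_digits : measurableTypeR R -> borel boundary)
    (isMeasurableFun.Build _ _ _ _ _ measurable_binary_digits).

Definition uniform_measure : probability (borel boundary) R :=
  distribution unit_measure binary_digits_mfun.

Lemma uniform_measure_uniform : is_uniform_measure uniform_measure.
Proof.
move=> w; rewrite /uniform_measure/=.
transitivity (lebesgue_measure (`[cylinder_left w, cylinder_left w + 2^-1 ^+ size w[%classic : set R)).
  rewrite /distribution /pushforward /unit_measure /mrestr; congr lebesgue_measure.
  have c0 := cylinder_left_ge0 w; have c1 := cylinder_left_le1 w.
  apply/seteqP; split=> x /=; rewrite !in_itv/=.
    by move=> [cx x01]; apply/binary_digits_cylinder.
  move=> h; have x01 : (0 <= x < 1)%R by case/andP: h => ? ?; apply/andP; split; lra.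
  by split=> //; apply/binary_digits_cylinder.
rewrite lebesgue_measure_itv/= lte_fin ltrDl exprn_gt0 ?invr_gt0//.
by rewrite -EFinB addrAC subrr add0r.
Qed.

Definition F_mfun : {mfun borel boundary >-> borel Sch} :=
  HB.pack (F : borel boundary -> borel Sch)
    (isMeasurableFun.Build _ _ _ _ _ measurable_F).

Definition base_point_mfun : {mfun borel Sch >-> borel boundary} :=
  HB.pack (base_point : borel Sch -> borel boundary)
    (isMeasurableFun.Build _ _ _ _ _ measurable_base_point).

Definition omega_measure : probability (borel Sch) R :=
  distribution uniform_measure F_mfun.
End BinaryDigits.

(** * The invariant measure *)

Definition generic_boundary : set (borel boundary) := ~` ones_orbit.

Definition generic_Omega : set (borel Sch) := Omega `&` base_point @^-1` generic_boundary.

Lemma measurable_generic_boundary : measurable generic_boundary.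
Proof. by apply: measurableC; exact: measurable_ones_orbit. Qed.

Lemma measurable_generic_Omega : measurable generic_Omega.
Proof.
apply: measurableI; first exact: (@closed_measurable_borel Sch _ Omega_closed).
rewrite -[X in measurable X]setTI; apply: measurable_base_point => //.
exact: measurable_generic_boundary.
Qed.

Lemma generic_OmegaE : generic_Omega = F @` generic_boundary.
Proof.
apply/seteqP; split=> [C [/Omega_cl clC nO]|_ [xi nO <-]].
  by exists (base_point C) => //; rewrite -cl_generic.
by split; [exact: Omega_generic|rewrite /preimage/= base_point_F].
Qed.

Lemma measurable_preimage_F (X : set (borel Sch)) :
  measurable X -> measurable (F @^-1` X : set (borel boundary)).
Proof.
by move=> mX; rewrite -[X in measurable X]setTI; apply: measurable_F.
Qed.

Lemma measurable_preimage_base_point (X : set (borel boundary)) :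
  measurable X -> measurable (base_point @^-1` X : set (borel Sch)).
Proof.
by move=> mX; rewrite -[X in measurable X]setTI; apply: measurable_base_point.
Qed.

Section OmegaMeasure.
Variable R : realType.
Local Open Scope ereal_scope.
Let mu := uniform_measure R.
Let nu := omega_measure R.

Lemma omega_measureE (X : set (borel Sch)) : nu X = mu (F @^-1` X).
Proof. by []. Qed.

Lemma omega_measure_invariant : measure_invariant sch_action nu.
Proof.
move=> g X mX; rewrite !omega_measureE.
have -> : F @^-1` (sch_action g @^-1` X) = B g @^-1` (F @^-1` X).
  by apply/seteqP; split=> xi; rewrite /preimage/= F_act.
apply: uniform_measure_act; first exact: uniform_measure_uniform.
exact: measurable_preimage_F.
Qed.

Lemma omega_measure_generic : nu (~` generic_Omega) = 0.
Proof.
rewrite omega_measureE.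
have -> : F @^-1` (~` generic_Omega) = ones_orbit.
  apply/seteqP; split=> xi; rewrite /preimage/=.
    move=> h; apply: contrapT => nO; apply: h; split; first exact: Omega_generic.
    by rewrite /preimage/= base_point_F.
  by move=> O [_]; rewrite /preimage/= base_point_F; apply.
by apply: uniform_measure_ones_orbit; exact: uniform_measure_uniform.
Qed.

Lemma omega_measure_supported : supported_on nu Omega.
Proof.
apply/eqP; rewrite -measure_le0 -omega_measure_generic; apply: le_measure; rewrite ?inE.
- by apply: measurableC; exact: (@closed_measurable_borel Sch _ Omega_closed).
- by apply: measurableC; exact: measurable_generic_Omega.
- by apply: subsetC => C [].
Qed.

(** The image of [nu'] on the boundary is uniform by level transitivity. Since the orbit of 1^oo is
    then null and [F] inverts [base_point] elsewhere on [Omega], this image determines [nu']. *)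
Lemma omega_measure_unique (nu' : probability (borel Sch) R) :
  measure_invariant sch_action nu' -> supported_on nu' Omega ->
  forall X : set (borel Sch), measurable X -> nu' X = nu X.
Proof.
move=> inv supp X mX.
have mO := @closed_measurable_borel Sch _ Omega_closed.
pose m : probability (borel boundary) R := distribution nu' base_point_mfun.
have mE (Y : set (borel boundary)) : m Y = nu' (base_point @^-1` Y) by [].
have um : is_uniform_measure m.
  apply: level_invariant_uniform => v w /level_transitive[g gvw].
  rewrite !mE -[RHS](inv g); last by apply: measurable_preimage_base_point; exact: measurable_cylinder.
  (* [base_point] is equivariant on the closure, so the two preimages of cylinders are compared only
     inside [Omega]. *)
  apply: (measure_eq_ae mO supp).
  - by apply: measurable_preimage_base_point; exact: measurable_cylinder.
  - apply: (@open_measurable_borel Sch).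
    apply: (open_comp (fun C _ => @sch_act_continuous g C)).
    apply: (open_comp (fun C _ => @base_point_continuous C)).
    exact: open_cylinder.
  - apply/seteqP; split=> C [+ OC]; rewrite /preimage/= base_point_act;
      do ?exact: Omega_cl; by move=> /gvw h; split.
have null : nu' (~` generic_Omega) = 0.
  have -> : ~` generic_Omega = ~` Omega `|` base_point @^-1` ones_orbit.
    by rewrite /generic_Omega setCI -preimage_setC /generic_boundary setCK.
  rewrite measureU0.
  - exact: supp.
  - exact: measurableC.
  - by apply: measurable_preimage_base_point; exact: measurable_ones_orbit.
  - exact: (uniform_measure_ones_orbit um).
have mFX := measurable_preimage_F mX.
(* On [generic_Omega] the map [F \o base_point] is the identity, so both sets agree there. *)
transitivity (nu' (base_point @^-1` (F @^-1` X))).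
  apply: (measure_eq_ae measurable_generic_Omega null) => //.
    exact: measurable_preimage_base_point.
  rewrite generic_OmegaE; apply/seteqP; split=> C [+ [xi nO xiC]];
    by rewrite -xiC /preimage/= base_point_F => ?; split=> //; exists xi.
transitivity (m (F @^-1` X)) => //; rewrite omega_measureE.
apply: boundary_measure_unique => //.
  by move=> w; transitivity ((2^-1 : R) ^+ size w)%:E%R;
    [exact: um|exact/esym/uniform_measure_uniform].
by rewrite [ltLHS](@probability_setT _ _ _ m) ltry.
Qed.

Lemma omega_measure_isomorphic :
  isomorphic_actions sch_action Omega nu boundary_action [set: boundary] mu.
Proof.
exists generic_Omega, generic_boundary, base_point; split.
- split.
  + exact: measurable_generic_Omega.
  + by move=> C [].
  + move=> g C [OC nO]; split; first exact: Omega_act.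
    rewrite /preimage/= base_point_act; last exact: Omega_cl.
    by move=> O; apply: nO; exact: (iffRL (@ones_orbit_act g _)).
  + exact: omega_measure_generic.
- split.
  + exact: measurable_generic_boundary.
  + by [].
  + by move=> g xi nO O; apply: nO; exact: (iffRL (@ones_orbit_act g _)).
  + rewrite /generic_boundary setCK.
    by apply: uniform_measure_ones_orbit; exact: uniform_measure_uniform.
- split.
    rewrite generic_OmegaE; split.
    + by move=> _ [xi nO <-]; rewrite base_point_F.
    + by move=> _ _ /set_mem[xi _ <-] /set_mem[zeta _ <-]; rewrite !base_point_F => ->.
    + by move=> xi nO; exists (F xi); [exists xi|exact: base_point_F].
  by move=> g C [OC _]; apply: base_point_act; exact: Omega_cl.
(* Images under [base_point] become preimages under its inverse [F], which makes their measurability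
   and measure accessible. *)
have imE (Y : set (borel Sch)) : Y `<=` generic_Omega ->
    base_point @` Y = generic_boundary `&` F @^-1` Y.
  move=> YX; apply/seteqP; split=> [_ [C YC <-]|xi [nO FY]]; last first.
    by exists (F xi) => //; exact: base_point_F.
  have := YX C YC; rewrite generic_OmegaE => -[xi nO xC].
  by rewrite -xC base_point_F; split=> //; rewrite /preimage/= xC.
- split.
  + move=> Y mY; apply: measurableI; first exact: measurable_generic_Omega.
    exact: measurable_preimage_base_point.
  + move=> Y mY /imE ->; apply: measurableI; first exact: measurable_generic_boundary.
    exact: measurable_preimage_F.
  + move=> Y mY YX; rewrite imE// omega_measureE.
    have mFY := measurable_preimage_F mY.
    apply: (measure_eq_ae measurable_generic_boundary) => //.
    * rewrite /generic_boundary setCK.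
      by apply: uniform_measure_ones_orbit; exact: uniform_measure_uniform.
    * by apply: measurableI => //; exact: measurable_generic_boundary.
    * by rewrite setIAC setIid setIC.
Qed.
End OmegaMeasure.

Theorem theorem1p2 (R : realType) :
  [/\ minimal_invariant_set sch_action Omega,
      (exists f : Sch -> boundary,
        [/\ {within Omega, continuous f},
            f @` Omega = [set: boundary],
            (forall g C, Omega C -> f (sch_action g C) = boundary_action g (f C)) &
            exists E : set boundary,
              [/\ countable E,
                  E !=set0,
                  (forall xi, E xi -> (Omega `&` f @^-1` [set xi] #= `I_3)%card) &
                  (forall xi, ~ E xi -> (Omega `&` f @^-1` [set xi] #= `I_1)%card)]]) &
      exists nu : probability (borel Sch) R,
        [/\ measure_invariant sch_action nu,
            supported_on nu Omega,
            (forall nu' : probability (borel Sch) R,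
               measure_invariant sch_action nu' -> supported_on nu' Omega ->
               forall X : set (borel Sch), measurable X -> nu' X = nu X) &
            exists2 mu : probability (borel boundary) R,
              is_uniform_measure mu &
              isomorphic_actions sch_action Omega nu
                                 boundary_action [set: boundary] mu]].
Proof.
split; [exact: Omega_minimal|exact: Omega_extension|].
exists (omega_measure R); split.
- exact: omega_measure_invariant.
- exact: omega_measure_supported.
- exact: omega_measure_unique.
- exists (uniform_measure R); first exact: uniform_measure_uniform.
  exact: omega_measure_isomorphic.
Qed.
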